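(* Define recursively, backward in $t=T-1,\dots,0$, starting from $a_T^+=a_T^-=b_T^+=b_T^-=0$: $\mathbf K_t^+\in\arg\min_{\mathbf K\in\mathbb R^n}F_t^+(\mathbf K)$, $\mathbf K_t^-\in\arg\min_{\mathbf K\in\mathbb R^n}F_t^-(\mathbf K)$ (with $F_t^\pm$ built from $a_{t+1}^\pm,b_{t+1}^\pm$), and $$a_t^+=\rho_{t+1}\mathbb E[\mathbf P_t]'\mathbf K_t^++\mathbb E[a_{t+1}^+Z_t^+1_{\{Z_t^+\ge0\}}]+\mathbb E[a_{t+1}^-Z_t^+1_{\{Z_t^+<0\}}],$$ $$a_t^-=\rho_{t+1}\mathbb E[\mathbf P_t]'\mathbf K_t^-+\mathbb E[a_{t+1}^+Z_t^-1_{\{Z_t^-\le0\}}]+\mathbb E[a_{t+1}^-Z_t^-1_{\{Z_t^->0\}}],$$ $$b_t^+=\rho_{t+1}^2(\mathbf K_t^+)'\mathbb E[\mathbf P_t\mathbf P_t']\mathbf K_t^++2\rho_{t+1}\mathbb E[a_{t+1}^+Z_t^+\mathbf P_t'\mathbf K_t^+1_{\{Z_t^+\ge0\}}]+2\rho_{t+1}\mathbb E[a_{t+1}^-Z_t^+\mathbf P_t'\mathbf K_t^+1_{\{Z_t^+<0\}}]+\mathbb E[b_{t+1}^+(Z_t^+)^21_{\{Z_t^+\ge0\}}]+\mathbb E[b_{t+1}^-(Z_t^+)^21_{\{Z_t^+<0\}}],$$ $$b_t^-=\rho_{t+1}^2(\mathbf K_t^-)'\mathbb E[\mathbf P_t\mathbf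 P_t']\mathbf K_t^-+2\rho_{t+1}\mathbb E[a_{t+1}^+Z_t^-\mathbf P_t'\mathbf K_t^-1_{\{Z_t^-\le0\}}]+2\rho_{t+1}\mathbb E[a_{t+1}^-Z_t^-\mathbf P_t'\mathbf K_t^-1_{\{Z_t^->0\}}]+\mathbb E[b_{t+1}^+(Z_t^-)^21_{\{Z_t^-\le0\}}]+\mathbb E[b_{t+1}^-(Z_t^-)^21_{\{Z_t^->0\}}],$$ where $Z_t^\pm=s_t+\mathbf P_t'\mathbf K_t^\pm$. Then these quantities are well defined (the minimizers exist), $b_t^+-(a_t^+)^2\ge0$ and $b_t^--(a_t^-)^2\ge0$ for all $t$, and the time consistent behavioral portfolio policy of the nested problem is, for $t=0,\dots,T-1$, $$\mathbf u_t^{TC}=\mathbf K_t^+(X_t-\rho_t^{-1}W)1_{\{X_t\ge\rho_t^{-1}W\}}+\mathbf K_t^-(X_t-\rho_t^{-1}W)1_{\{X_t<\rho_t^{-1}W\}}.$$ Moreover, the mean and variance of the terminal wealth under this policy are $$\mathbb E[X_T\mid X_0]=\rho_0X_0+a_0^+(X_0-\rho_0^{-1}W)1_{\{X_0\ge\rho_0^{-1}W\}}+a_0^-(X_0-\rho_0^{-1}W)1_{\{X_0<\rho_0^{-1}W\}},$$ $$\mathrm{Var}(X_T\mid X_0)=\Big[(b_0^+-(a_0^+)^2)1_{\{X_0\ge\rho_0^{-1}W\}}+(b_0^--(a_0^-)^2)1_{\{X_0<\rho_0^{-1}W\}}\Big](X_0-\rho_0^{-1}W)^2.$$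
   Context: Market: $T$ periods, one risk-free asset with deterministic gross return $s_t>1$ in period $t$, and $n$ risky assets with random gross return vector $\mathbf e_t$ in period $t$. The excess return vector is $\mathbf P_t=\mathbf e_t-s_t\mathbf 1\in\mathbb R^n$. The vectors $\mathbf P_0,\dots,\mathbf P_{T-1}$ are statistically independent, absolutely continuous, with finite first and second moments, and each covariance matrix $\mathrm{Cov}(\mathbf P_t)=\mathbb E[\mathbf P_t\mathbf P_t']-\mathbb E[\mathbf P_t]\mathbb E[\mathbf P_t]'$ is positive definite. The market is arbitrage-free; in particular, for every nonzero $\mathbf L\in\mathbb R^n$, neither $\mathbf P_t'\mathbf L\le 0$ a.s. nor $\mathbf P_t'\mathbf L\ge 0$ a.s. holds. Write $\rho_t=\prod_{j=t}^{T-1}s_j$ for $t<T$ and $\rho_T=1$. Wealth dynamics: $X_{t+1}=s_tX_t+\mathbf P_t'\mathbf u_t$, where $\mathbf u_t\in\mathbb R^n$ (amounts in risky assets) is a Markov feedback policy, i.e. a deterministic function of the current wealth $X_t$. An investment target $W\in\mathbb R$ is fixed. Behavioral risk aversion: for constants $\gamma_t^+,\gamma_t^-\ge0$, $\gamma_t(X_t)=\gamma_t^+(X_t-\rho_t^{-1}W)$ if $X_t\ge\rho_t^{-1}W$, and $\gamma_t(X_t)=-\gamma_t^-(X_t-\rho_t^{-1}W)$ if $X_t<\rho_t^{-1}W$. Time consistent policy (nested mean-variance problem): a Markov policy $(\mathbf u_0^{TC},\dots,\mathbf u_{T-1}^{TC})$ is time consistent if for every $t$ and every wealth level $X_t$,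 $\mathbf u_t^{TC}(X_t)$ minimizes over $\mathbf u_t\in\mathbb R^n$ the objective $\mathrm{Var}(X_T\mid X_t)-\gamma_t(X_t)\mathbb E[X_T\mid X_t]$, where $X_{t+1}=s_tX_t+\mathbf P_t'\mathbf u_t$ and $X_{j+1}=s_jX_j+\mathbf P_j'\mathbf u_j^{TC}(X_j)$ for $j=t+1,\dots,T-1$. Definition of $F_t^\pm:\mathbb R^n\to\mathbb R$, given deterministic numbers $a_{t+1}^\pm,b_{t+1}^\pm,\gamma_t^\pm$, writing $Z=s_t+\mathbf P_t'\mathbf K$: $$F_t^+(\mathbf K)=\rho_{t+1}^2\mathbf K'\mathrm{Cov}(\mathbf P_t)\mathbf K+\mathbb E\big[(2\rho_{t+1}a_{t+1}^++b_{t+1}^+)Z^21_{\{Z\ge0\}}\big]+\mathbb E\big[(2\rho_{t+1}a_{t+1}^-+b_{t+1}^-)Z^21_{\{Z<0\}}\big]-M_+^2-2\rho_{t+1}M_+\,(s_t+\mathbb E[\mathbf P_t]'\mathbf K)-\gamma_t^+M_+-\rho_{t+1}\gamma_t^+(s_t+\mathbb E[\mathbf P_t]'\mathbf K),$$ where $M_+=\mathbb E[a_{t+1}^+Z1_{\{Z\ge0\}}]+\mathbb E[a_{t+1}^-Z1_{\{Z<0\}}]$; and $$F_t^-(\mathbf K)=\rho_{t+1}^2\mathbf K'\mathrm{Cov}(\mathbf P_t)\mathbf K+\mathbb E\big[(2\rho_{t+1}a_{t+1}^++b_{t+1}^+)Z^21_{\{Z\le0\}}\big]+\mathbb E\big[(2\rho_{t+1}a_{t+1}^-+b_{t+1}^-)Z^21_{\{Z>0\}}\big]-M_-^2-2\rho_{t+1}M_-\,(s_t+\mathbb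 E[\mathbf P_t]'\mathbf K)+\gamma_t^-M_-+\rho_{t+1}\gamma_t^-(s_t+\mathbb E[\mathbf P_t]'\mathbf K),$$ where $M_-=\mathbb E[a_{t+1}^+Z1_{\{Z\le0\}}]+\mathbb E[a_{t+1}^-Z1_{\{Z>0\}}]$. *)

(* Defs.v *)
From HB Require Import structures.
From mathcomp Require Import all_boot all_order all_algebra.
From mathcomp Require Import all_classical all_reals all_analysis.

Set Implicit Arguments.
Unset Strict Implicit.
Unset Printing Implicit Defensive.

Import Order.TTheory GRing.Theory Num.Theory.
Local Open Scope classical_set_scope.
Local Open Scope ring_scope.

Section Market.
Context {d : measure_display} {Omega : measurableType d} {R : realType}.
Variable (P : probability Omega R).
Variable (n : nat).

(* Real-valued expectation (all expectations used below are of integrable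
   functions under the standing assumptions). *)
Definition Ex (X : Omega -> R) : R := fine ('E_P[X])%E.

(* ---- the excess returns: Pc t i w = i-th coordinate of P_t(w) ---- *)
Variable Pc : nat -> 'I_n -> Omega -> R.

Definition vecP (t : nat) (w : Omega) : 'rV[R]_n := \row_i Pc t i w.

Definition pK (t : nat) (K : 'rV[R]_n) (w : Omega) : R :=
  \sum_(i < n) Pc t i w * K ord0 i.

Definition meanP (t : nat) : 'rV[R]_n := \row_i Ex (Pc t i).
Definition secondP (t : nat) : 'M[R]_n :=
  \matrix_(i, j) Ex (fun w => Pc t i w * Pc t j w).
Definition covP (t : nat) : 'M[R]_n := secondP t - (meanP t)^T *m meanP t.

Definition quad (M : 'M[R]_n) (K : 'rV[R]_n) : R := (K *m M *m K^T) ord0 ord0.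
Definition meanK (t : nat) (K : 'rV[R]_n) : R := (meanP t *m K^T) ord0 ord0.

Definition sigmaP (t : nat) : set (set Omega) :=
  <<s [set A | exists i B, measurable B /\ A = Pc t i @^-1` B] >>.

Definition indep_returns (N : nat) : Prop :=
  forall A : nat -> set Omega, (forall t, (t < N)%N -> sigmaP t (A t)) ->
  P (\bigcap_(t in [set t | (t < N)%N]) A t) = (\prod_(t < N) P (A t))%E.

Definition box (a b : 'rV[R]_n) : set 'rV[R]_n :=
  [set x | forall i, a ord0 i <= x ord0 i <= b ord0 i].
Definition boxvol (a b : 'rV[R]_n) : R := \prod_(i < n) (b ord0 i - a ord0 i).

Definition leb_null (Nset : set 'rV[R]_n) : Prop :=
  forall e : R, 0 < e -> exists a b : nat -> 'rV[R]_n,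
    (forall k i, a k ord0 i <= b k ord0 i) /\
    Nset `<=` \bigcup_k box (a k) (b k) /\
    (forall m, \sum_(k < m) boxvol (a k) (b k) <= e).

Definition abs_cont (t : nat) : Prop :=
  forall Nset, leb_null Nset -> P.-negligible [set w | Nset (vecP t w)].

Definition market_assumptions (N : nat) (s : nat -> R) : Prop :=
  [/\ forall t, (t < N)%N -> 1 < s t,
      forall t i, (t < N)%N -> measurable_fun setT (Pc t i),
      forall t i, (t < N)%N ->
        P.-integrable setT (EFin \o Pc t i) /\
        P.-integrable setT (EFin \o (fun w => Pc t i w ^+ 2)),
      indep_returns N &
      [/\ forall t, (t < N)%N -> abs_cont t,
          forall t, (t < N)%N -> forall K : 'rV[R]_n, K != 0 -> 0 < quad (covP t) K
        & forall t, (t < N)%N -> forall L : 'rV[R]_n, L != 0 ->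
            ~ {ae P, forall w, pK t L w <= 0} /\
            ~ {ae P, forall w, 0 <= pK t L w}]].

Variables (N : nat) (s : nat -> R) (W : R) (gp gm : nat -> R).

Definition rho (t : nat) : R := \prod_(t <= j < N) s j.

Definition lvl (t : nat) : R := (rho t)^-1 * W.

Definition gam (t : nat) (x : R) : R :=
  if lvl t <= x then gp t * (x - lvl t) else - (gm t * (x - lvl t)).

Section F.
Variables (t : nat) (ap am bp bm : R). (* a_{t+1}^+, a_{t+1}^-, b_{t+1}^+, b_{t+1}^- *)

Definition Zt (K : 'rV[R]_n) (w : Omega) : R := s t + pK t K w.

Definition Mplus (K : 'rV[R]_n) : R :=
  Ex (fun w => if 0 <= Zt K w then ap * Zt K w else 0) +
  Ex (fun w => if Zt K w < 0 then am * Zt K w else 0).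

Definition Fplus (K : 'rV[R]_n) : R :=
  (rho t.+1) ^+ 2 * quad (covP t) K
  + Ex (fun w => if 0 <= Zt K w then (2 * rho t.+1 * ap + bp) * Zt K w ^+ 2 else 0)
  + Ex (fun w => if Zt K w < 0 then (2 * rho t.+1 * am + bm) * Zt K w ^+ 2 else 0)
  - Mplus K ^+ 2
  - 2 * rho t.+1 * Mplus K * (s t + meanK t K)
  - gp t * Mplus K
  - rho t.+1 * gp t * (s t + meanK t K).

Definition Mminus (K : 'rV[R]_n) : R :=
  Ex (fun w => if Zt K w <= 0 then ap * Zt K w else 0) +
  Ex (fun w => if 0 < Zt K w then am * Zt K w else 0).

Definition Fminus (K : 'rV[R]_n) : R :=
  (rho t.+1) ^+ 2 * quad (covP t) K
  + Ex (fun w => if Zt K w <= 0 then (2 * rho t.+1 * ap + bp) * Zt K w ^+ 2 else 0)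
  + Ex (fun w => if 0 < Zt K w then (2 * rho t.+1 * am + bm) * Zt K w ^+ 2 else 0)
  - Mminus K ^+ 2
  - 2 * rho t.+1 * Mminus K * (s t + meanK t K)
  + gm t * Mminus K
  + rho t.+1 * gm t * (s t + meanK t K).

Definition a_plus (K : 'rV[R]_n) : R :=
  rho t.+1 * meanK t K
  + Ex (fun w => if 0 <= Zt K w then ap * Zt K w else 0)
  + Ex (fun w => if Zt K w < 0 then am * Zt K w else 0).

Definition a_minus (K : 'rV[R]_n) : R :=
  rho t.+1 * meanK t K
  + Ex (fun w => if Zt K w <= 0 then ap * Zt K w else 0)
  + Ex (fun w => if 0 < Zt K w then am * Zt K w else 0).

Definition b_plus (K : 'rV[R]_n) : R :=
  (rho t.+1) ^+ 2 * quad (secondP t) K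
  + 2 * rho t.+1 * Ex (fun w => if 0 <= Zt K w then ap * Zt K w * pK t K w else 0)
  + 2 * rho t.+1 * Ex (fun w => if Zt K w < 0 then am * Zt K w * pK t K w else 0)
  + Ex (fun w => if 0 <= Zt K w then bp * Zt K w ^+ 2 else 0)
  + Ex (fun w => if Zt K w < 0 then bm * Zt K w ^+ 2 else 0).

Definition b_minus (K : 'rV[R]_n) : R :=
  (rho t.+1) ^+ 2 * quad (secondP t) K
  + 2 * rho t.+1 * Ex (fun w => if Zt K w <= 0 then ap * Zt K w * pK t K w else 0)
  + 2 * rho t.+1 * Ex (fun w => if 0 < Zt K w then am * Zt K w * pK t K w else 0)
  + Ex (fun w => if Zt K w <= 0 then bp * Zt K w ^+ 2 else 0)
  + Ex (fun w => if 0 < Zt K w then bm * Zt K w ^+ 2 else 0).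
End F.

Definition is_argmin (F : 'rV[R]_n -> R) (K : 'rV[R]_n) : Prop :=
  forall K' : 'rV[R]_n, F K <= F K'.

Definition recursion_from (t0 : nat) (Kp Km : nat -> 'rV[R]_n)
    (ap am bp bm : nat -> R) : Prop :=
  [/\ ap N = 0, am N = 0, bp N = 0, bm N = 0 &
    forall t, (t0 <= t < N)%N ->
      [/\ is_argmin (Fplus t (ap t.+1) (am t.+1) (bp t.+1) (bm t.+1)) (Kp t),
          is_argmin (Fminus t (ap t.+1) (am t.+1) (bp t.+1) (bm t.+1)) (Km t) &
       [/\ ap t = a_plus t (ap t.+1) (am t.+1) (Kp t),
          am t = a_minus t (ap t.+1) (am t.+1) (Km t),
          bp t = b_plus t (ap t.+1) (am t.+1) (bp t.+1) (bm t.+1) (Kp t) &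
          bm t = b_minus t (ap t.+1) (am t.+1) (bp t.+1) (bm t.+1) (Km t)]]].

(* A Markov policy: pol t x = amounts u_t invested in the risky assets
   when the wealth at time t is x. *)
Definition policy := nat -> R -> 'rV[R]_n.

Fixpoint run (pol : policy) (t m : nat) (X : Omega -> R) : Omega -> R :=
  match m with
  | 0 => X
  | m'.+1 => run pol t.+1 m' (fun w => s t * X w + pK t (pol t (X w)) w)
  end.

Definition XT_from (pol : policy) (t : nat) (x : R) (u : 'rV[R]_n) : Omega -> R :=
  run pol t.+1 (N - t.+1) (fun w => s t * x + pK t u w).

Definition XT (pol : policy) (x0 : R) : Omega -> R := run pol 0 N (cst x0).

(* Var(X_N | X_t = x) - gamma_t(x) E[X_N | X_t = x] *)
Definition nested_obj (pol : policy) (t : nat) (x : R) (u : 'rV[R]_n) : \bar R :=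
  ('V_P[XT_from pol t x u] - (gam t x)%:E * 'E_P[XT_from pol t x u])%E.

Definition time_consistent (pol : policy) : Prop :=
  forall t, (t < N)%N -> forall (x : R) (u : 'rV[R]_n),
    (nested_obj pol t x (pol t x) <= nested_obj pol t x u)%E.

Definition uTC (Kp Km : nat -> 'rV[R]_n) : policy := fun t x =>
  if lvl t <= x then (x - lvl t) *: Kp t else (x - lvl t) *: Km t.

End Market.

(* Main.v *)
(* Work with the deviation y_t = X_t - W / rho_t. The policy is positively homogeneous
   in y, so y_N = |y_t| G, where G is the terminal deviation started from the sign of
   y_t, and G depends only on the returns from period t on. With
   alpha = rho + a and q = b + 2 rho a + rho^2 the recursion becomes
     alpha_t = E[alpha_{t+1}^{sgn Z} Z],   q_t = E[q_{t+1}^{sgn Z} Z^2],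
   that is, alpha and q are the first two moments of G per unit of deviation; by
   independence the nested objective equals y^2 F(K) up to a constant for u = y K.

   Minimizers exist because F(K) = H(Z_K) - gamma E[alpha^{sgn Z_K} Z_K] with
     H(Z) = E[(q - alpha^2)^{sgn Z} Z^2] + Var(alpha^{sgn Z} Z),
   and H(P'K) is positively 2-homogeneous, continuous, and positive for K <> 0. The
   positivity rests on the invariant "q >= alpha^2, and alpha > 0 if q = alpha^2": it
   forces Z to be a.s. constant as soon as H(Z) = 0, which positive definiteness of the
   covariance excludes for K <> 0, and it is propagated backward by the same fact. *)
Require Import Defs.
From HB Require Import structures.
From mathcomp Require Import all_boot all_order all_algebra.
From mathcomp Require Import all_classical all_reals all_analysis measurable_realfun.
From mathcomp Require Import ring lra.

Import Order.TTheory GRing.Theory Num.Theory.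
Import numFieldNormedType.Exports.
Local Open Scope ring_scope.

Set Implicit Arguments.
Unset Strict Implicit.
Unset Printing Implicit Defensive.

(** * Real expectations *)

Section Expectation.
Context {d : measure_display} {Omega : measurableType d} {R : realType}.
Variable P : probability Omega R.
Implicit Types (X Y f g : Omega -> R) (k : R).

Definition integ f := P.-integrable setT (EFin \o f).

Lemma integ_measurable f : integ f -> measurable_fun setT f.
Proof. by move=> /measurable_int /measurable_EFinP. Qed.

Lemma integ_le f g : measurable_fun setT f ->
  (forall w, `|f w| <= g w) -> integ g -> integ f.
Proof.
move=> mf fg; apply: le_integrable => //; first exact/measurable_EFinP.
by move=> w _ /=; rewrite lee_fin (le_trans (fg w))// ler_norm.
Qed.

Lemma integ_cst k : integ (fun=> k).
Proof. exact: finite_measure_integrable_cst. Qed.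

Lemma integD f g : integ f -> integ g -> integ (fun w => f w + g w).
Proof. by move=> fi gi; apply: (integrableD _ fi gi). Qed.

Lemma integZ k f : integ f -> integ (fun w => k * f w).
Proof. by move=> fi; apply: (integrableZl _ k fi). Qed.

Lemma integB f g : integ f -> integ g -> integ (fun w => f w - g w).
Proof. by move=> fi gi; apply: (integrableB _ fi gi). Qed.

Lemma integ_norm f : integ f -> integ (fun w => `|f w|).
Proof. exact: integrable_norm. Qed.

Lemma ExK f : integ f -> 'E_P[f]%E = (Ex P f)%:E.
Proof. by move=> fi; rewrite /Ex fineK// unlock; exact: integrable_fin_num. Qed.

Lemma Ex_Rintegral f : Ex P f = (\int[P]_w f w)%R.
Proof. by rewrite /Ex unlock. Qed.

Lemma eq_Ex f g : f =1 g -> Ex P f = Ex P g.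
Proof. by move=> /funext ->. Qed.

Lemma Ex_cst k : Ex P (fun=> k) = k.
Proof. by rewrite /Ex expectation_cst. Qed.

Lemma ExD f g : integ f -> integ g -> Ex P (fun w => f w + g w) = Ex P f + Ex P g.
Proof. by move=> fi gi; rewrite !Ex_Rintegral RintegralD. Qed.

Lemma ExB f g : integ f -> integ g -> Ex P (fun w => f w - g w) = Ex P f - Ex P g.
Proof. by move=> fi gi; rewrite !Ex_Rintegral RintegralB. Qed.

Lemma ExZ k f : integ f -> Ex P (fun w => k * f w) = k * Ex P f.
Proof. by move=> fi; rewrite !Ex_Rintegral RintegralZl. Qed.

Lemma Ex_sum (I : Type) (r : seq I) (F : I -> Omega -> R) :
  (forall i, integ (F i)) ->
  integ (fun w => \sum_(i <- r) F i w) /\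
  Ex P (fun w => \sum_(i <- r) F i w) = \sum_(i <- r) Ex P (F i).
Proof.
move=> Fi; elim: r => [|i r [IH1 IH2]].
  rewrite big_nil (_ : (fun _ => _) = fun=> 0); last by apply/funext => w; rewrite big_nil.
  by rewrite Ex_cst; split => //; exact: integ_cst.
rewrite (_ : (fun _ => _) = fun w => F i w + \sum_(j <- r) F j w); last first.
  by apply/funext => w; rewrite big_cons.
by split; [exact: integD|rewrite ExD// IH2 big_cons].
Qed.

Lemma Ex_ge0 f : (forall w, 0 <= f w) -> 0 <= Ex P f.
Proof. by move=> f0; rewrite Ex_Rintegral Rintegral_ge0. Qed.

Lemma Ex_le f g : integ f -> integ g -> (forall w, f w <= g w) -> Ex P f <= Ex P g.
Proof. by move=> fi gi fg; rewrite !Ex_Rintegral le_Rintegral. Qed.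

Lemma Ex_norm_le f g : integ f -> integ g -> (forall w, `|f w| <= g w) ->
  `|Ex P f| <= Ex P g.
Proof.
move=> fi gi fg; rewrite (le_trans _ (Ex_le (integ_norm fi) gi fg))//.
by rewrite !Ex_Rintegral le_normr_Rintegral.
Qed.

Lemma Ex_eq0 f : integ f -> (forall w, 0 <= f w) -> Ex P f = 0 ->
  {ae P, forall w, f w = 0}.
Proof.
move=> fi f0 Ef.
have : (\int[P]_w `|(EFin \o f) w| = 0)%E.
  transitivity ('E_P[f])%E; last by rewrite ExK// Ef.
  rewrite unlock; apply: eq_integral => w _ /=.
  by rewrite ger0_norm.
move/(ae_eq_integral_abs P measurableT (measurable_int _ fi)).
by apply: filterS => w /= /(_ I) [].
Qed.

Lemma variance_Ex X : integ X -> integ (fun w => X w ^+ 2) ->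
  'V_P[X]%E = (Ex P (fun w => X w ^+ 2) - Ex P X ^+ 2)%:E.
Proof.
move=> Xi X2i; rewrite /variance covarianceE; first last.
- exact/Lfun1_integrable.
- exact/Lfun1_integrable.
- exact/Lfun1_integrable.
by rewrite !ExK// -EFinM -EFinB -expr2.
Qed.

(** Square integrability serves as the single regularity condition: it is stable under sums and
    bounded factors, and it yields the integrability of first moments and of products. *)
Definition L2 X := measurable_fun setT X /\ integ (fun w => X w ^+ 2).

Lemma L2_integ X : L2 X -> integ X.
Proof.
move=> [mX X2]; apply: integ_le mX _ (integD (integ_cst 1) X2) => w /=.
by rewrite -real_normK ?num_real//; have := normr_ge0 (X w); nra.
Qed.

Lemma L2_integM X Y : L2 X -> L2 Y -> integ (fun w => X w * Y w).
Proof.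
move=> [mX X2] [mY Y2]; apply: integ_le (integD X2 Y2).
  exact: measurable_funM.
move=> w /=; have := sqr_ge0 (X w + Y w); have := sqr_ge0 (X w - Y w).
have := sqr_ge0 (X w); have := sqr_ge0 (Y w); move: (X w) (Y w) => x y ? ? ? ?.
rewrite ler_norml; apply/andP; split; nra.
Qed.

Lemma L2_cst k : L2 (fun=> k).
Proof. by split; [exact: measurable_cst|exact: integ_cst]. Qed.

Lemma L2D X Y : L2 X -> L2 Y -> L2 (fun w => X w + Y w).
Proof.
move=> [mX X2] [mY Y2]; split; first exact: measurable_funD.
apply: integ_le (integZ 2 (integD X2 Y2)).
  by apply: measurable_funX; exact: measurable_funD.
move=> w /=; rewrite ger0_norm ?sqr_ge0//; have := sqr_ge0 (X w - Y w).
by move: (X w) (Y w) => x y ?; nra.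
Qed.

Lemma L2M (U : Omega -> R) X k : L2 X -> measurable_fun setT U ->
  (forall w, `|U w| <= k) -> L2 (fun w => U w * X w).
Proof.
move=> [mX X2] mU Uk; split; first exact: measurable_funM.
apply: integ_le (integZ (k ^+ 2) X2).
  by apply: measurable_funX; exact: measurable_funM.
move=> w /=; rewrite ger0_norm ?sqr_ge0// exprMn ler_wpM2r ?sqr_ge0//.
by rewrite -[leLHS]real_normK ?num_real// ler_sqr ?nnegrE// (le_trans _ (Uk w)).
Qed.

Lemma L2Z k X : L2 X -> L2 (fun w => k * X w).
Proof. by move=> X2; apply: (L2M (k := `|k|)). Qed.

Lemma L2_sum (I : Type) (r : seq I) (F : I -> Omega -> R) :
  (forall i, L2 (F i)) -> L2 (fun w => \sum_(i <- r) F i w).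
Proof.
move=> F2; elim: r => [|i r IH].
  by rewrite (_ : (fun _ => _) = fun=> 0); [exact: L2_cst|apply/funext=> w; rewrite big_nil].
rewrite (_ : (fun _ => _) = fun w => F i w + \sum_(j <- r) F j w).
  exact: L2D.
by apply/funext=> w; rewrite big_cons.
Qed.

End Expectation.
Arguments eq_Ex {d Omega R P f} g.

Ltac integ_tac := repeat first
  [ assumption | exact: integ_cst | exact: L2_cst | apply: L2D | apply: L2Z
  | apply: integD | apply: integB | apply: integZ | apply: L2_integM
  | apply: L2_integ ].

(** * Zero variance and almost sure constancy *)

Section Variance.
Context {d : measure_display} {Omega : measurableType d} {R : realType}.
Variable P : probability Omega R.
Implicit Types (X : Omega -> R) (k : R).
Local Notation integ := (integ P).
Local Notation L2 := (L2 P).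

Lemma var_ge0 X : L2 X -> 0 <= Ex P (fun w => X w ^+ 2) - Ex P X ^+ 2.
Proof.
move=> X2; rewrite -lee_fin -variance_Ex; [exact: variance_ge0|exact: L2_integ|by case: X2].
Qed.

(** The variance is the mean of the nonnegative variable [(X - c) ^+ 2] with [c] the mean of [X],
    and a nonnegative variable of mean zero vanishes almost surely. *)
Lemma var_eq0 X : L2 X -> Ex P (fun w => X w ^+ 2) - Ex P X ^+ 2 = 0 ->
  {ae P, forall w, X w = Ex P X}.
Proof.
move=> X2 v0; pose c := Ex P X.
have Xc : L2 (fun w => X w - c) by apply: L2D => //; exact: L2_cst.
have Ec : Ex P (fun w => (X w - c) ^+ 2) = 0.
  rewrite -v0 (eq_Ex (fun w => X w ^+ 2 + (- 2 * c * X w + c ^+ 2))).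
    have iX := L2_integ X2.
    have iX2 := proj2 X2.
    rewrite ExD ?ExD ?ExZ ?Ex_cst; try by integ_tac.
    by rewrite -/c; ring.
  by move=> w /=; ring.
have := Ex_eq0 (proj2 Xc) (fun w => sqr_ge0 _) Ec.
by apply: filterS => w /eqP; rewrite sqrf_eq0 subr_eq0 => /eqP.
Qed.

Lemma var_ae_cst X k : L2 X -> {ae P, forall w, X w = k} ->
  Ex P (fun w => X w ^+ 2) - Ex P X ^+ 2 = 0.
Proof.
move=> X2 Xk.
have E1 : Ex P X = k.
  rewrite -[RHS](Ex_cst P) /Ex unlock; congr fine; apply: ae_eq_integral => //.
  - exact: measurable_int (L2_integ X2).
  - by apply: filterS Xk => w /= -> _.
have E2 : Ex P (fun w => X w ^+ 2) = k ^+ 2.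
  rewrite -[RHS](Ex_cst P) /Ex unlock; congr fine; apply: ae_eq_integral => //.
  - exact: measurable_int (proj2 X2).
  - by apply: filterS Xk => w /= -> _.
by rewrite E1 E2 subrr.
Qed.

End Variance.

(** * Piecewise linear functions with a kink at zero *)

Section SignedSlope.
Context {R : realType}.
Implicit Types p m z : R.

(** The function [sel p m z * z] is linear with slope [p] to the right of zero and [m] to the left.
    The convention at [z = 0] disappears after multiplication by [z]. *)
Definition sel p m z : R := if 0 <= z then p else m.

Lemma measurable_sel p m : measurable_fun setT (sel p m).
Proof.
by apply: measurable_fun_ifT => //; apply: measurable_fun_ler.
Qed.

Lemma sel_bound p m z : `|sel p m z| <= `|p| + `|m|.
Proof. by rewrite /sel; case: ifP => _; rewrite (lerDl, lerDr). Qed.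

Lemma selpZ k p m z : 0 < k -> sel p m (k * z) = sel p m z.
Proof. by move=> k0; rewrite /sel pmulr_rge0. Qed.

Lemma sel_neg p m z : z != 0 -> sel p m (- z) = sel m p z.
Proof. by move=> z0; rewrite /sel oppr_ge0; case: ltgtP z0. Qed.

Lemma selN_lin p m z : sel p m (- z) * z = sel m p z * z.
Proof.
by have [->|z0] := eqVneq z 0; [rewrite !mulr0|rewrite sel_neg].
Qed.

(** [sel] jumps at zero, but its product with the argument does not: for [x] and [y] of opposite
    signs, both [|x|] and [|y|] are at most [|x - y|]. *)
Lemma sel_lip p m x y :
  `|sel p m x * x - sel p m y * y| <= (`|p| + `|m|) * `|x - y|.
Proof.
rewrite /sel; case: ifPn => x0; case: ifPn => y0.
- by rewrite -mulrBr normrM ler_wpM2r// lerDl.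
- rewrite -ltNge in y0.
  rewrite (le_trans (ler_normB _ _))// !normrM (gtr0_norm (_ : 0 < x - y)); last lra.
  rewrite (ger0_norm x0) (ltr0_norm y0).
  by have := normr_ge0 p; have := normr_ge0 m; nra.
- rewrite -ltNge in x0.
  rewrite (le_trans (ler_normB _ _))// !normrM (ltr0_norm (_ : x - y < 0)); last lra.
  rewrite (ger0_norm y0) (ltr0_norm x0).
  by have := normr_ge0 p; have := normr_ge0 m; nra.
- by rewrite -mulrBr normrM ler_wpM2r// lerDr.
Qed.

Lemma sel_sqr_lip p m x y :
  `|sel p m x * x ^+ 2 - sel p m y * y ^+ 2|
    <= (`|p| + `|m|) * (`|x - y| * (`|x| + `|y|)).
Proof.
rewrite /sel; case: ifPn => x0; case: ifPn => y0.
- rewrite -mulrBr normrM subr_sqr normrM ler_pM// ?lerDl//.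
  by rewrite ler_wpM2l// ler_normD.
- rewrite -ltNge in y0.
  rewrite (le_trans (ler_normB _ _))// !normrM ?normrX (gtr0_norm (_ : 0 < x - y)); last lra.
  rewrite (ger0_norm x0) (ltr0_norm y0).
  have p0 := normr_ge0 p; have m0 := normr_ge0 m.
  rewrite mulrDl lerD// ler_wpM2l//; nra.
- rewrite -ltNge in x0.
  rewrite (le_trans (ler_normB _ _))// !normrM ?normrX (ltr0_norm (_ : x - y < 0)); last lra.
  rewrite (ger0_norm y0) (ltr0_norm x0).
  have p0 := normr_ge0 p; have m0 := normr_ge0 m.
  rewrite addrC mulrDl lerD// ler_wpM2l//; nra.
- rewrite -mulrBr normrM subr_sqr normrM ler_pM// ?lerDr//.
  by rewrite ler_wpM2l// ler_normD.
Qed.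

End SignedSlope.

(** * Coercivity and dispersion *)

Section Coercivity.
Context {R : realType} {n : nat}.
Implicit Types (f g : 'rV[R]_n -> R) (K : 'rV[R]_n).

(** The local form is the one needed, since the objective has a quadratic part, whose Lipschitz
    constant grows with [K]. *)
Lemma loc_lipschitz_continuous f :
  (forall K, exists L : R, forall K', `|K - K'| <= 1 -> `|f K - f K'| <= L * `|K - K'|) ->
  continuous f.
Proof.
move=> fl K; have [L fL] := fl K.
apply/(@cvgrPdist_lt R R^o 'rV[R]_n (nbhs K) (nbhs_filter K)) => e e0; rewrite near_simpl; apply/(@nbhs_ballP R 'rV[R]_n).
have L0 : 0 < `|L| + 1 by rewrite ltr_wpDl.
exists (Num.min 1 (e / (`|L| + 1))) => /=; first by rewrite lt_min ltr01 divr_gt0.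
move=> K'; rewrite -ball_normE /= lt_min => /andP[/ltW K1 Le].
rewrite (le_lt_trans (fL _ K1))//.
rewrite ltr_pdivlMr// in Le.
have := normr_ge0 (K - K'); have := ler_norm L.
by move: `|K - K'| Le => x; nra.
Qed.

Lemma compact_level_set (A : set R) (r : R) : closed A -> (forall x, A x -> x <= r) ->
  compact [set K : 'rV[R]_n | A `|K|].
Proof.
move=> Acl Ar; apply: bounded_closed_compact.
  by exists r; split=> [|x rx K /= /Ar Kr]; rewrite ?num_real// (le_trans Kr)// ltW.
by apply: (preimage_closed (f := fun K => `|K|)) => // K _; exact: norm_continuous.
Qed.

(** Outside a large enough ball the lower bound exceeds [f 0], so a minimizer over the compact ball
    is a global one. *)
Lemma coercive_argmin f (c B D : R) : continuous f -> 0 < c ->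
  (forall K, c * `|K| ^+ 2 - (B + D * `|K|) <= f K) ->
  exists K, is_argmin f K.
Proof.
(* The radius is chosen so that [c * r = c + |f 0| + |B| + |D|] and [r >= 1]; for [|K'| > r] the
   quadratic term then dominates [|f 0| + |B| + |D| * |K'|]. *)
move=> fc c0 fK; pose r := 1 + (`|f 0| + `|B| + `|D|) / c.
have r1 : 1 <= r by rewrite lerDl divr_ge0 ?addr_ge0// ltW.
have [K] : exists2 K, K \in [set K : 'rV[R]_n | `|K| <= r]%classic &
    forall K', K' \in [set K : 'rV[R]_n | `|K| <= r]%classic -> f K <= f K'.
  apply: EVT_min_rV.
  - by exists 0 => /=; rewrite normr0 (le_trans _ r1).
  - by apply: (@compact_level_set [set x | x <= r]%classic r) => //; exact: closed_le.
  - exact: continuous_subspaceT.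
rewrite inE /= => Kr Kmin; exists K => K'.
have [K'r|rK'] := leP `|K'| r; first by apply: Kmin; rewrite inE.
apply: (@le_trans _ _ (f 0)); first by apply: Kmin; rewrite inE /= normr0 (le_trans _ r1).
apply: le_trans (fK K').
have cr : c * r = c + (`|f 0| + `|B| + `|D|) by rewrite /r mulrDr mulr1 mulrCA divff ?mulr1// gt_eqF.
have k1 : 1 <= `|K'| by rewrite (le_trans r1)// ltW.
have f0 := ler_norm (f 0); have B0 := ler_norm B; have D0 := ler_norm D.
have f1 := normr_ge0 (f 0); have B1 := normr_ge0 B; have D1 := normr_ge0 D.
have h1 : c * r * `|K'| <= c * `|K'| ^+ 2.
  by rewrite expr2 mulrA ler_wpM2r// ler_wpM2l// ltW.
rewrite cr in h1.
move: `|K'| k1 h1 {rK'} => k k1 h1.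
have : (`|f 0| + `|B|) * 1 <= (`|f 0| + `|B|) * k by rewrite ler_wpM2l ?addr_ge0.
have : D * k <= `|D| * k by rewrite ler_wpM2r// (le_trans _ k1).
have : 0 <= c * k by rewrite mulr_ge0 ?(le_trans _ k1)// ltW.
by lra.
Qed.

(** The constant is the minimum of [g] on the unit sphere, which is positive by compactness;
    homogeneity carries the bound to every [K]. *)
Lemma quadratic_growth g : continuous g ->
  (forall k K, 0 <= k -> g (k *: K) = k ^+ 2 * g K) ->
  (forall K, K != 0 -> 0 < g K) ->
  exists2 c : R, 0 < c & forall K, c * `|K| ^+ 2 <= g K.
Proof.
move=> gc gh gp.
have g0 : g 0 = 0 by rewrite -(scale0r (0 : 'rV[R]_n)) gh// expr0n mul0r.
have sc K : K != 0 -> `| `|K|^-1 *: K | = 1.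
  by move=> K0; rewrite normrZ ger0_norm ?invr_ge0// mulVf// normr_eq0.
(* The sphere is empty when [n = 0]; then every [K] is zero and any positive constant will do. *)
have [[K1 K1n]|noK] := pselect (exists K : 'rV[R]_n, `|K| = 1); last first.
  exists 1 => // K; have [->|K0] := eqVneq K 0; first by rewrite normr0 g0 expr0n mulr0.
  by exfalso; apply: noK; exists (`|K|^-1 *: K); exact: sc.
have [Km] : exists2 K, K \in [set K : 'rV[R]_n | `|K| = 1]%classic &
    forall K', K' \in [set K : 'rV[R]_n | `|K| = 1]%classic -> g K <= g K'.
  apply: EVT_min_rV.
  - by exists K1.
  - by apply: (@compact_level_set [set x | x = 1]%classic 1) => [|x ->//]; exact: closed_eq.
  - exact: continuous_subspaceT.
rewrite inE /= => Km1 Kmin; exists (g Km).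
  by apply: gp; rewrite -normr_eq0 Km1 oner_eq0.
move=> K; have [->|K0] := eqVneq K 0; first by rewrite normr0 g0 expr0n mulr0.
rewrite -[K in leRHS](scalerKV (a := `|K|)) ?normr_eq0// gh// mulrC.
by rewrite ler_wpM2l ?sqr_ge0// Kmin// inE /= sc.
Qed.

End Coercivity.

(** * Moments and dispersion under sign-dependent slopes *)

Section Dispersion.
Context {d : measure_display} {Omega : measurableType d} {R : realType}.
Variable P : probability Omega R.
Implicit Types (X Z T : Omega -> R) (p m q r k : R).
Local Notation integ := (integ P).
Local Notation L2 := (L2 P).

Definition mom1 p m Z := Ex P (fun w => sel p m (Z w) * Z w).
Definition mom2 q r Z := Ex P (fun w => sel q r (Z w) * Z w ^+ 2).
(** This is the variance of [Z] times a factor that, given [Z], has mean [p] and second moment [q]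
    where [Z >= 0], and mean [m] and second moment [r] where [Z < 0]. *)
Definition disp p m q r Z := mom2 q r Z - mom1 p m Z ^+ 2.

(* The invariant of the backward recursion; its second clause rules out two-point laws
   of [Z] on which [sel p m Z * Z] would be constant. *)
Definition nondegenerate p q := 0 <= q - p ^+ 2 /\ (q = p ^+ 2 -> 0 < p).

Lemma L2_sel p m Z : L2 Z -> L2 (fun w => sel p m (Z w) * Z w).
Proof.
move=> Z2; apply: (L2M (k := `|p| + `|m|)) => //.
- by apply: measurableT_comp (measurable_sel p m) _; case: Z2.
- by move=> w; exact: sel_bound.
Qed.

Lemma integ_sel2 q r Z : L2 Z -> integ (fun w => sel q r (Z w) * Z w ^+ 2).
Proof.
move=> Z2; rewrite (_ : (fun _ => _) = fun w => sel q r (Z w) * Z w * Z w).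
  by apply: L2_integM => //; exact: L2_sel.
by apply/funext => w; rewrite -mulrA.
Qed.

(** Law of total variance: the mean of the conditional variance, plus the variance of the
    conditional mean [sel p m Z * Z]. *)
Lemma disp_split p m q r Z : L2 Z ->
  disp p m q r Z = mom2 (q - p ^+ 2) (r - m ^+ 2) Z +
    (Ex P (fun w => (sel p m (Z w) * Z w) ^+ 2) - mom1 p m Z ^+ 2).
Proof.
move=> Z2; rewrite /disp addrA; congr (_ - _); rewrite /mom2 -ExD.
- by apply: eq_Ex => w; rewrite /sel; case: ifP => _; ring.
- exact: integ_sel2.
- by case: (L2_sel p m Z2).
Qed.

Lemma mom2_ge0 q r Z : 0 <= q -> 0 <= r -> 0 <= mom2 q r Z.
Proof.
move=> q0 r0; apply: Ex_ge0 => w; rewrite mulr_ge0 ?sqr_ge0//.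
by rewrite /sel; case: ifP.
Qed.

Lemma disp_ge0 p m q r Z : nondegenerate p q -> nondegenerate m r -> L2 Z ->
  0 <= disp p m q r Z.
Proof.
move=> [q0 _] [r0 _] Z2; rewrite disp_split// addr_ge0 ?mom2_ge0//.
exact/var_ge0/L2_sel.
Qed.

(* Almost surely both [sel (q - p^2) (r - m^2) Z * Z^2] vanishes and
   [sel p m Z * Z] equals its mean; nondegeneracy makes the joint
   level set of these two functions of [Z] a single point. *)
Lemma disp_eq0 p m q r Z : nondegenerate p q -> nondegenerate m r -> L2 Z ->
  disp p m q r Z = 0 -> exists k, {ae P, forall w, Z w = k}.
Proof.
move=> [q0 pq] [r0 mr] Z2; rewrite disp_split// => /eqP.
have Y2 := L2_sel p m Z2.
rewrite paddr_eq0 ?mom2_ge0 ?var_ge0// => /andP[/eqP E1 /eqP E2].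
have A2 := var_eq0 Y2 E2; rewrite -/(mom1 p m Z) in A2.
have A1 : {ae P, forall w, sel (q - p ^+ 2) (r - m ^+ 2) (Z w) * Z w ^+ 2 = 0}.
  apply: Ex_eq0 => //; first exact: integ_sel2.
  by move=> w; rewrite mulr_ge0 ?sqr_ge0// /sel; case: ifP.
set c := mom1 p m Z in A2 E2.
have uniq1 : forall z z', sel (q - p ^+ 2) (r - m ^+ 2) z * z ^+ 2 = 0 ->
    sel (q - p ^+ 2) (r - m ^+ 2) z' * z' ^+ 2 = 0 ->
    sel p m z * z = c -> sel p m z' * z' = c -> z = z'.
  have pos z : 0 <= z -> sel (q - p ^+ 2) (r - m ^+ 2) z * z ^+ 2 = 0 -> z = 0 \/ 0 < p.
    rewrite /sel => -> /eqP; rewrite mulf_eq0 subr_eq0 sqrf_eq0.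
    by move=> /orP[/eqP|/eqP]; [right; exact: pq|left].
  have neg z : z < 0 -> sel (q - p ^+ 2) (r - m ^+ 2) z * z ^+ 2 = 0 -> 0 < m.
    move=> z0; rewrite /sel leNgt z0 /= => /eqP; rewrite mulf_eq0 subr_eq0 sqrf_eq0.
    by rewrite (lt_eqF z0) orbF => /eqP/mr.
  (* A point [z >= 0] forces [c >= 0] and a point [z < 0] forces [c < 0], so mixed signs are
     contradictory; for equal signs the positive slope gives [z = z']. *)
  move=> z z'; have [z0|z0] := leP 0 z; have [z'0|z'0] := leP 0 z'.
  - move=> /(pos _ z0) h /(pos _ z'0) h'; rewrite /sel z0 z'0 => <-.
    by case: h => [zz|p0]; case: h' => [zz'|p0'] e; nra.
  - move=> /(pos _ z0) h /(neg _ z'0) h'; rewrite /sel z0 leNgt z'0/= => <-.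
    by case: h => [zz|p0] e; nra.
  - move=> /(neg _ z0) h /(pos _ z'0) h'; rewrite /sel z'0 leNgt z0/= => <-.
    by case: h' => [zz|p0] e; nra.
  - move=> /(neg _ z0) h /(neg _ z'0) h'; rewrite /sel !leNgt z0 z'0/= => <-.
    by move=> e; nra.
(* If the joint level set is empty, the two almost sure equations contradict each other, and any
   constant works vacuously. *)
have [[k [k1 k2]]|nok] := pselect (exists z,
    sel (q - p ^+ 2) (r - m ^+ 2) z * z ^+ 2 = 0 /\ sel p m z * z = c).
  by exists k; apply: filterS2 A1 A2 => w h1 h2; exact: uniq1.
by exists 0; apply: filterS2 A1 A2 => w h1 h2; exfalso; apply: nok; exists (Z w).
Qed.

Lemma mom1Z p m k Z : 0 <= k -> L2 Z -> mom1 p m (fun w => k * Z w) = k * mom1 p m Z.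
Proof.
move=> k0 Z2; rewrite /mom1 -ExZ; last exact/L2_integ/L2_sel.
apply: eq_Ex => w; move: k0; rewrite le_eqVlt => /predU1P[<-|k0]; first by rewrite !mul0r mulr0.
by rewrite selpZ// mulrCA.
Qed.

Lemma mom2Z q r k Z : 0 <= k -> L2 Z ->
  mom2 q r (fun w => k * Z w) = k ^+ 2 * mom2 q r Z.
Proof.
move=> k0 Z2; rewrite /mom2 -ExZ; last exact/integ_sel2.
apply: eq_Ex => w; move: k0; rewrite le_eqVlt => /predU1P[<-|k0].
  by rewrite !mul0r expr0n mulr0 mul0r.
by rewrite selpZ// exprMn mulrCA.
Qed.

Lemma dispZ p m q r k Z : 0 <= k -> L2 Z ->
  disp p m q r (fun w => k * Z w) = k ^+ 2 * disp p m q r Z.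
Proof. by move=> k0 Z2; rewrite /disp mom2Z// mom1Z//; ring. Qed.

(** Reflection exchanges the two slopes. Wealth below the target is treated this way: a deviation of
    [-1] becomes [- Z] after one period. *)
Lemma mom1N p m Z : L2 Z -> mom1 p m (fun w => - Z w) = - mom1 m p Z.
Proof.
move=> Z2; rewrite /mom1 -mulN1r -ExZ; last exact/L2_integ/L2_sel.
by apply: eq_Ex => w; rewrite mulrN selN_lin mulN1r.
Qed.

Lemma mom2N q r Z : mom2 q r (fun w => - Z w) = mom2 r q Z.
Proof.
by apply: eq_Ex => w; rewrite sqrrN !expr2 !mulrA selN_lin.
Qed.

Lemma dispN p m q r Z : L2 Z -> disp p m q r (fun w => - Z w) = disp m p r q Z.
Proof. by move=> Z2; rewrite /disp mom2N mom1N// sqrrN. Qed.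

(** * Lipschitz dependence of the moments on [Z], under a common envelope [T] *)

Section Lipschitz.
Variables (T : Omega -> R) (e b : R) (Z Z' : Omega -> R).
Hypotheses (T2 : L2 T) (T1 : forall w, 1 <= T w) (Z2 : L2 Z) (Z2' : L2 Z').
Hypothesis Ze : forall w, `|Z w - Z' w| <= e * T w.
Hypothesis Zb : forall w, `|Z w| + `|Z' w| <= b * T w.

Let tau := Ex P (fun w => T w ^+ 2).

Let TT w : T w <= T w ^+ 2.
Proof. by rewrite expr2 ler_peMl ?T1// (le_trans _ (T1 w)). Qed.

Let e0 : 0 <= e.
Proof.
have := Ze point; have := T1 point; have := normr_ge0 (Z point - Z' point).
by move=> h1 h2 h3; rewrite -(@pmulr_lge0 _ (T point)) ?(lt_le_trans _ h2)// (le_trans h1 h3).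
Qed.

Let b0 : 0 <= b.
Proof.
have := Zb point; have := T1 point; have := normr_ge0 (Z point); have := normr_ge0 (Z' point).
move=> h0 h1 h2 h3; rewrite -(@pmulr_lge0 _ (T point)) ?(lt_le_trans _ h2)//.
by rewrite (le_trans _ h3)// addr_ge0.
Qed.

(** The pointwise bound is linear in [T]; it is weakened by [T <= T ^+ 2] so that the estimates for
    both moments share the constant [tau]. *)
Lemma mom1_lip p m : `|mom1 p m Z - mom1 p m Z'| <= (`|p| + `|m|) * tau * e.
Proof.
have S := L2_sel p m Z2; have S' := L2_sel p m Z2'.
rewrite /mom1 -ExB; [|exact: L2_integ..].
rewrite -mulrA (mulrC tau) mulrA -ExZ; last by case: T2.
apply: Ex_norm_le; first by apply: integB; exact: L2_integ.
  by apply: integZ; case: T2.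
move=> w; rewrite (le_trans (sel_lip _ _ _ _))// -mulrA ler_wpM2l ?addr_ge0//.
by rewrite (le_trans (Ze w))// ler_wpM2l.
Qed.

Lemma mom1_bound p m : `|mom1 p m Z| <= (`|p| + `|m|) * tau * b.
Proof.
have S := L2_sel p m Z2.
rewrite -mulrA (mulrC tau) mulrA -ExZ; last by case: T2.
apply: Ex_norm_le; first exact: L2_integ.
  by apply: integZ; case: T2.
move=> w; rewrite normrM -mulrA ler_pM ?sel_bound//.
apply: (@le_trans _ _ (b * T w)); last by rewrite ler_wpM2l.
by rewrite (le_trans _ (Zb w))// lerDl.
Qed.

Lemma mom2_lip q r : `|mom2 q r Z - mom2 q r Z'| <= (`|q| + `|r|) * tau * (e * b).
Proof.
have S := integ_sel2 q r Z2; have S' := integ_sel2 q r Z2'.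
rewrite /mom2 -ExB//.
rewrite -mulrA (mulrC tau) mulrA -ExZ; last by case: T2.
apply: Ex_norm_le; first exact: integB.
  by apply: integZ; case: T2.
move=> w; rewrite (le_trans (sel_sqr_lip _ _ _ _))// -mulrA ler_wpM2l ?addr_ge0//.
rewrite [leRHS](_ : _ = e * T w * (b * T w)); last by ring.
by rewrite ler_pM// addr_ge0.
Qed.

End Lipschitz.

(** The difference of the squared means factors into a difference of order [e] and a sum of order
    [b], matching the order [e * b] of the second moments. *)
Lemma disp_lip T tau e b Z Z' p m q r : Ex P (fun w => T w ^+ 2) = tau -> L2 T -> (forall w, 1 <= T w) -> L2 Z -> L2 Z' ->
  (forall w, `|Z w - Z' w| <= e * T w) ->
  (forall w, `|Z w| + `|Z' w| <= b * T w) ->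
  `|disp p m q r Z - disp p m q r Z'| <=
    ((`|q| + `|r|) * tau + 2 * ((`|p| + `|m|) * tau) ^+ 2) * (e * b).
Proof.
move=> ET T2 T1 Z2 Z2' Ze Zb.
have h1 := mom1_lip T2 T1 Z2 Z2' Ze p m; have h2 := mom2_lip T2 Z2 Z2' Ze Zb q r.
have h3 := mom1_bound T2 T1 Z2 Zb p m.
have h4 : `|mom1 p m Z'| <= (`|p| + `|m|) * tau * b.
  by rewrite -ET; apply: (mom1_bound (Z' := Z)) => // w; rewrite addrC Zb.
rewrite ET in h1 h2 h3.
rewrite (_ : _ - _ = (mom2 q r Z - mom2 q r Z') -
  (mom1 p m Z - mom1 p m Z') * (mom1 p m Z + mom1 p m Z')); last by rewrite /disp; ring.
rewrite (le_trans (ler_normB _ _))// [leRHS]mulrDl lerD// normrM.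
rewrite [leRHS](_ : _ = ((`|p| + `|m|) * tau * e) * (2 * ((`|p| + `|m|) * tau * b))); last by ring.
rewrite ler_pM//.
by rewrite (le_trans (ler_normD _ _))//; lra.
Qed.

End Dispersion.

(** * One period *)

Section OnePeriod.
Context {d : measure_display} {Omega : measurableType d} {R : realType}.
Variables (P : probability Omega R) (n : nat) (Pc : nat -> 'I_n -> Omega -> R).
Variable t : nat.
Hypothesis PcL2 : forall i, L2 P (Pc t i).
Implicit Types K : 'rV[R]_n.
Local Notation pK := (pK Pc t).
Local Notation L2 := (L2 P).

Lemma L2_pK K : L2 (pK K).
Proof.
apply: L2_sum => i; rewrite (_ : (fun _ => _) = fun w => K ord0 i * Pc t i w).
  exact: L2Z.
by apply/funext => w; rewrite mulrC.
Qed.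

Lemma pKZ k K w : pK (k *: K) w = k * pK K w.
Proof. by rewrite /Defs.pK mulr_sumr; apply: eq_bigr => i _; rewrite mxE mulrCA. Qed.

Lemma pK0 w : pK 0 w = 0.
Proof. by rewrite -(scale0r (0 : 'rV[R]_n)) pKZ mul0r. Qed.

Lemma pKB K K' w : pK (K - K') w = pK K w - pK K' w.
Proof. by rewrite /Defs.pK -sumrB; apply: eq_bigr => i _; rewrite !mxE mulrBr. Qed.

Lemma entry_le_norm K i : `|K ord0 i| <= `|K|.
Proof.
rewrite [leRHS]/Num.norm /= mx_normrE.
exact: (le_bigmax _ (fun ij => `|K ij.1 ij.2|) (ord0, i)).
Qed.

(** Envelope for all affine functions of the returns: [|c + pK K w| <= (|c| + |K|) * S w]. The
    summand [1] absorbs the constants and ensures [S >= 1]. *)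
Let S w := 1 + \sum_(i < n) `|Pc t i w|.

Let S_ge1 w : 1 <= S w.
Proof. by rewrite lerDl sumr_ge0. Qed.

Let L2_S : L2 S.
Proof.
apply: L2D; first exact: L2_cst.
apply: L2_sum => i; split.
  by apply: measurableT_comp => //; case: (PcL2 i).
rewrite (_ : (fun _ => _) = fun w => Pc t i w ^+ 2); first by case: (PcL2 i).
by apply/funext => w; rewrite real_normK ?num_real.
Qed.

Let pK_le K w : `|pK K w| <= `|K| * S w.
Proof.
apply: (@le_trans _ _ (`|K| * \sum_(i < n) `|Pc t i w|)).
  rewrite (le_trans (ler_norm_sum _ _ _))// mulr_sumr ler_sum// => i _.
  by rewrite normrM mulrC ler_wpM2r// entry_le_norm.
by rewrite ler_wpM2l// lerDr.
Qed.

Lemma meanKE K : meanK P Pc t K = Ex P (pK K).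
Proof.
have iK i : integ P (fun w => Pc t i w * K ord0 i).
  by apply: L2_integM; [exact: PcL2|exact: L2_cst].
rewrite /meanK /meanP mxE /Defs.pK.
have [_ ->] := Ex_sum (index_enum 'I_n) iK.
apply: eq_bigr => i _; rewrite !mxE mulrC -ExZ; last exact: L2_integ.
by apply: eq_Ex => w; rewrite mulrC.
Qed.

Lemma quad_secondE K : quad (secondP P Pc t) K = Ex P (fun w => pK K w ^+ 2).
Proof.
have iij i j : integ P (fun w => (K ord0 i * K ord0 j) * (Pc t i w * Pc t j w)).
  by apply: integZ; exact: L2_integM.
rewrite (eq_Ex (fun w => \sum_j \sum_i (K ord0 i * K ord0 j) * (Pc t i w * Pc t j w))).
  have [_ ->] := Ex_sum (index_enum 'I_n)
    (fun j => proj1 (Ex_sum (index_enum 'I_n) (fun i => iij i j))).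
  rewrite /quad mxE; apply: eq_bigr => j _.
  have [_ ->] := Ex_sum (index_enum 'I_n) (fun i => iij i j).
  rewrite !mxE mulr_suml; apply: eq_bigr => i _; rewrite ExZ; last exact: L2_integM.
  by rewrite !mxE mulrAC.
move=> w; rewrite expr2 [X in X * _]/Defs.pK [RHS]exchange_big /= mulr_suml.
apply: eq_bigr => i _; rewrite /Defs.pK mulr_sumr; apply: eq_bigr => j _.
by ring.
Qed.

Lemma quad_covE K :
  quad (covP P Pc t) K = Ex P (fun w => pK K w ^+ 2) - Ex P (pK K) ^+ 2.
Proof.
rewrite -quad_secondE -meanKE /quad /covP mulmxBr mulmxBl [LHS]mxE [X in _ + X]mxE.
congr (_ - _); rewrite mulmxA -mulmxA mxE big_ord1 expr2 /meanK.
by rewrite -[K in X in X * _ = _]trmxK -trmx_mul mxE.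
Qed.

(** * Existence of minimizers and propagation of nondegeneracy *)

Section Minimizer.
Hypothesis cov_pos : forall K, K != 0 -> 0 < quad (covP P Pc t) K.
Variables p m q r : R.
Hypotheses (pq : nondegenerate p q) (mr : nondegenerate m r).

Let Z (c : R) K (w : Omega) := c + pK K w.

Lemma L2_affine c K : L2 (fun w => c + pK K w).
Proof. by apply: L2D; [exact: L2_cst|exact: L2_pK]. Qed.

(** An almost surely constant [c + pK K] makes the variance of [pK K] vanish, and that variance is
    the covariance form at [K]. *)
Lemma affine_ae_cst c K k : {ae P, forall w, c + pK K w = k} -> K = 0.
Proof.
move=> Zk; apply: contrapT => /eqP/cov_pos; rewrite quad_covE.
rewrite (var_ae_cst (k := k - c)) ?ltxx//; first exact: L2_pK.
by apply: filterS Zk => w <-; rewrite addrC addKr.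
Qed.

Lemma disp_affine_eq0 c K : disp P p m q r (fun w => c + pK K w) = 0 -> K = 0.
Proof.
by move=> /(disp_eq0 pq mr (L2_affine c K)) [k]; exact: affine_ae_cst.
Qed.

(** Equality in the new pair means zero dispersion, hence [K = 0] and [Z] is the constant [c > 0].
    The new pair is then [p * c] and [q * c ^+ 2], so [q = p ^+ 2], and [p > 0] gives
    [p * c > 0]. *)
Lemma nondegenerate_step c K : 0 < c ->
  nondegenerate (mom1 P p m (fun w => c + pK K w)) (mom2 P q r (fun w => c + pK K w)).
Proof.
move=> c0; split; first exact/disp_ge0/L2_affine.
move=> /eqP; rewrite -subr_eq0 => /eqP D0; have K0 := disp_affine_eq0 D0.
have ZE : (fun w => c + pK K w) = (fun=> c).
  by apply/funext => w; rewrite K0 pK0 addr0.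
move: D0; rewrite ZE /mom1 /mom2 !Ex_cst /sel ltW// exprMn -mulrBl => /eqP.
rewrite mulf_eq0 sqrf_eq0 (gt_eqF c0) orbF subr_eq0 => /eqP.
by move=> /(proj2 pq) p0; rewrite mulr_gt0.
Qed.

Let tau := Ex P (fun w => S w ^+ 2).

Let Z_dist c c' K K' w : `|Z c K w - Z c' K' w| <= (`|c - c'| + `|K - K'|) * S w.
Proof.
rewrite (_ : _ - _ = (c - c') + pK (K - K') w); last by rewrite /Z pKB; ring.
rewrite (le_trans (ler_normD _ _))// mulrDl lerD//.
by rewrite ler_peMr.
Qed.

Let Z_size c c' K K' w :
  `|Z c K w| + `|Z c' K' w| <= (`|c| + `|c'| + `|K| + `|K'|) * S w.
Proof.
rewrite (_ : _ * S w = (`|c| + `|K|) * S w + (`|c'| + `|K'|) * S w); last by ring.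
have h (x : R) L : `|Z x L w| <= (`|x| + `|L|) * S w.
  by rewrite (le_trans (ler_normD _ _))// mulrDl lerD// ler_peMr.
by rewrite lerD.
Qed.

Let C1 := (`|p| + `|m|) * tau.
Let C2 := (`|q| + `|r|) * tau + 2 * C1 ^+ 2.

Let tau0 : 0 <= tau. Proof. by apply: Ex_ge0 => w; exact: sqr_ge0. Qed.
Let C10 : 0 <= C1. Proof. by rewrite mulr_ge0// addr_ge0. Qed.
Let C20 : 0 <= C2.
Proof. by rewrite addr_ge0 ?mulr_ge0// ?addr_ge0// sqr_ge0. Qed.

(** Both arguments vary: with [c = c'] this gives continuity in [K], and with [K = K'], [c' = 0] it
    compares the objective with its homogeneous part. *)
Let disp_Z_lip c c' K K' :
  `|disp P p m q r (Z c K) - disp P p m q r (Z c' K')|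
    <= C2 * ((`|c - c'| + `|K - K'|) * (`|c| + `|c'| + `|K| + `|K'|)).
Proof.
exact: (disp_lip _ _ _ _ (erefl tau) L2_S S_ge1 (L2_affine c K) (L2_affine c' K')
  (Z_dist c c' K K') (Z_size c c' K K')).
Qed.

Let mom1_Z_lip c c' K K' :
  `|mom1 P p m (Z c K) - mom1 P p m (Z c' K')| <= C1 * (`|c - c'| + `|K - K'|).
Proof.
exact: (mom1_lip L2_S S_ge1 (L2_affine c K) (L2_affine c' K') (Z_dist c c' K K')).
Qed.

Let objective_continuous g c :
  continuous (fun K => disp P p m q r (Z c K) - g * mom1 P p m (Z c K)).
Proof.
apply: loc_lipschitz_continuous => K.
(* For [|K - K'| <= 1] one has [|K'| <= |K| + 1], which bounds the size factor of [disp_Z_lip]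
   independently of [K']. *)
exists (C2 * (2 * `|c| + 2 * `|K| + 1) + `|g| * C1) => K' K1.
have h1 := disp_Z_lip c c K K'; have h2 := mom1_Z_lip c c K K'.
rewrite subrr normr0 add0r in h1 h2.
rewrite (_ : _ - _ = (disp P p m q r (Z c K) - disp P p m q r (Z c K')) -
  g * (mom1 P p m (Z c K) - mom1 P p m (Z c K'))); last by ring.
rewrite (le_trans (ler_normB _ _))// [leRHS]mulrDl lerD//; last first.
  by rewrite normrM -mulrA ler_wpM2l.
rewrite (le_trans h1)// -mulrA ler_wpM2l// mulrC ler_wpM2r//.
have : `|K'| <= `|K| + `|K - K'|.
  by rewrite -{1}(subKr K K') (le_trans (ler_normB _ _)).
by lra.
Qed.

(** At [c = 0] the dispersion is 2-homogeneous and positive off zero, so it grows quadratically.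
    Restoring [c] and adding the mean term change it by at most an affine function of [|K|], which
    leaves the objective coercive. *)
Lemma objective_argmin g c : exists K, is_argmin
  (fun K => disp P p m q r (fun w => c + pK K w) - g * mom1 P p m (fun w => c + pK K w)) K.
Proof.
have cont0 : continuous (fun K => disp P p m q r (Z 0 K)).
  have := @objective_continuous 0 0.
  rewrite (_ : (fun _ => _) = fun K => disp P p m q r (Z 0 K))//.
  by apply/funext => K; rewrite mul0r subr0.
have Z0 K : Z 0 K = pK K by apply/funext => w; rewrite /Z add0r.
have [||a a0 growth] := quadratic_growth cont0.
- move=> k K k0; rewrite !Z0 -dispZ//; last exact: L2_pK.
  by congr (disp _ _ _ _ _ _); apply/funext => w; rewrite pKZ.
- move=> K K0; rewrite lt_neqAle disp_ge0// ?andbT; last exact: L2_affine.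
  by apply: contra_neq K0 => /esym; exact: disp_affine_eq0.
apply: (@coercive_argmin _ _ _ a (C2 * `|c| ^+ 2 + `|g| * C1 * `|c|)
   (2 * C2 * `|c| + `|g| * C1)) => //; first exact: objective_continuous.
move=> K; rewrite -/(Z c K).
have h1 := disp_Z_lip c 0 K K; have h2 := mom1_Z_lip c 0 K 0.
have h3 : mom1 P p m (Z 0 0) = 0.
  rewrite -[RHS](Ex_cst P); apply: eq_Ex => w.
  by rewrite /Z pK0 addr0 mulr0.
rewrite h3 !subr0 in h2; rewrite subrr subr0 !normr0 !addr0 in h1.
have h4 := growth K.
have h5 : g * mom1 P p m (Z c K) <= `|g| * (C1 * (`|c| + `|K|)).
  by rewrite (le_trans (ler_norm _))// normrM ler_wpM2l.
have h6 : disp P p m q r (Z 0 K) - disp P p m q r (Z c K) <=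
    C2 * (`|c| * (`|c| + `|K| + `|K|)).
  by rewrite (le_trans (ler_norm _))// distrC.
by lra.
Qed.

End Minimizer.
End OnePeriod.

(** * The recursion in terms of moments *)

Section Identities.
Context {d : measure_display} {Omega : measurableType d} {R : realType}.
Variables (P : probability Omega R) (n : nat) (Pc : nat -> 'I_n -> Omega -> R).
Variables (N : nat) (s : nat -> R) (t : nat).
Hypothesis PcL2 : forall i, L2 P (Pc t i).
Variables (gp gm : nat -> R) (K : 'rV[R]_n).
Local Notation pK := (pK Pc t K).
Local Notation Z := (Zt Pc s t K).
Local Notation rho := (rho N s t.+1).
Local Notation Ex := (Ex P).
Local Notation mom1 := (mom1 P).
Local Notation mom2 := (mom2 P).

Let L2Zt : L2 P Z.
Proof. exact: L2_affine. Qed.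

Let i1 p m : integ P (fun w => sel p m (Z w) * Z w).
Proof. exact/L2_integ/L2_sel. Qed.

Let i2 p m : integ P (fun w => sel p m (Z w) * Z w ^+ 2).
Proof. exact/integ_sel2. Qed.

Let mom1D p m p' m' : mom1 p m Z + mom1 p' m' Z = mom1 (p + p') (m + m') Z.
Proof.
rewrite /mom1 -ExD//.
by apply: eq_Ex => w; rewrite /sel; case: ifP => _; ring.
Qed.

Let mom2D p m p' m' : mom2 p m Z + mom2 p' m' Z = mom2 (p + p') (m + m') Z.
Proof.
rewrite /mom2 -ExD//.
by apply: eq_Ex => w; rewrite /sel; case: ifP => _; ring.
Qed.

Let mom1c c : mom1 c c Z = c * Ex Z.
Proof.
rewrite /mom1 -ExZ; last exact: L2_integ.
by apply: eq_Ex => w; rewrite /sel; case: ifP.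
Qed.

Let mom2c c : mom2 c c Z = c * Ex (fun w => Z w ^+ 2).
Proof.
rewrite /mom2 -ExZ; last by case: L2Zt.
by apply: eq_Ex => w; rewrite /sel; case: ifP.
Qed.

Let Ex_Z : Ex Z = s t + Ex pK.
Proof. by rewrite ExD ?Ex_cst//; [exact: integ_cst|exact/L2_integ/L2_pK]. Qed.

Let Ex_Z2 : Ex (fun w => Z w ^+ 2) = s t ^+ 2 + 2 * s t * Ex pK + Ex (fun w => pK w ^+ 2).
Proof.
have iK := L2_integ (L2_pK PcL2 K); have [_ iK2] := L2_pK PcL2 K.
rewrite (eq_Ex (fun w => s t ^+ 2 + (2 * s t * pK w + pK w ^+ 2))); last first.
  by move=> w; rewrite /Zt; ring.
rewrite !ExD ?ExZ ?Ex_cst; try by integ_tac.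
by ring.
Qed.

Let ge1 c : Ex (fun w => if 0 <= Z w then c * Z w else 0) = mom1 c 0 Z.
Proof. by apply: eq_Ex => w; rewrite /sel; case: ifP; rewrite ?mul0r. Qed.
Let lt1 c : Ex (fun w => if Z w < 0 then c * Z w else 0) = mom1 0 c Z.
Proof. by apply: eq_Ex => w; rewrite /sel; case: leP; rewrite ?mul0r. Qed.
(** Here the event [Z = 0] lies on the other side than in [sel]; the factor [Z] in the integrand
    makes this harmless. *)
Let le1 c : Ex (fun w => if Z w <= 0 then c * Z w else 0) = mom1 0 c Z.
Proof. by apply: eq_Ex => w; rewrite /sel; case: ltgtP => [_|_|->]; rewrite ?mul0r ?mulr0. Qed.
Let gt1 c : Ex (fun w => if 0 < Z w then c * Z w else 0) = mom1 c 0 Z.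
Proof. by apply: eq_Ex => w; rewrite /sel; case: ltgtP => [_|_|<-]; rewrite ?mul0r ?mulr0. Qed.

Let ge2 c : Ex (fun w => if 0 <= Z w then c * Z w ^+ 2 else 0) = mom2 c 0 Z.
Proof. by apply: eq_Ex => w; rewrite /sel; case: ifP; rewrite ?mul0r. Qed.
Let lt2 c : Ex (fun w => if Z w < 0 then c * Z w ^+ 2 else 0) = mom2 0 c Z.
Proof. by apply: eq_Ex => w; rewrite /sel; case: leP; rewrite ?mul0r. Qed.
Let le2 c : Ex (fun w => if Z w <= 0 then c * Z w ^+ 2 else 0) = mom2 0 c Z.
Proof. by apply: eq_Ex => w; rewrite /sel; case: ltgtP => [_|_|->]; rewrite ?mul0r ?expr0n ?mulr0. Qed.
Let gt2 c : Ex (fun w => if 0 < Z w then c * Z w ^+ 2 else 0) = mom2 c 0 Z.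
Proof. by apply: eq_Ex => w; rewrite /sel; case: ltgtP => [_|_|<-]; rewrite ?mul0r ?expr0n ?mulr0. Qed.

(** Since [pK = Z - s t], the mixed expectations in [b_plus] and [b_minus] reduce to moments of [Z]
    alone. *)
Let cross p m :
  Ex (fun w => sel p m (Z w) * Z w * pK w) = mom2 p m Z - s t * mom1 p m Z.
Proof.
rewrite /mom2 /mom1 -ExZ// -ExB//; last exact: integZ.
by apply: eq_Ex => w; rewrite /Zt; ring.
Qed.
Let gex c : Ex (fun w => if 0 <= Z w then c * Z w * pK w else 0) = mom2 c 0 Z - s t * mom1 c 0 Z.
Proof. by rewrite -cross; apply: eq_Ex => w; rewrite /sel; case: ifP; rewrite ?mul0r. Qed.
Let ltx c : Ex (fun w => if Z w < 0 then c * Z w * pK w else 0) = mom2 0 c Z - s t * mom1 0 c Z.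
Proof. by rewrite -cross; apply: eq_Ex => w; rewrite /sel; case: leP; rewrite ?mul0r. Qed.
Let lex c : Ex (fun w => if Z w <= 0 then c * Z w * pK w else 0) = mom2 0 c Z - s t * mom1 0 c Z.
Proof.
rewrite -cross; apply: eq_Ex => w; rewrite /sel.
by case: ltgtP => [_|_|->]; rewrite ?mul0r ?mulr0 ?mul0r.
Qed.
Let gtx c : Ex (fun w => if 0 < Z w then c * Z w * pK w else 0) = mom2 c 0 Z - s t * mom1 c 0 Z.
Proof.
rewrite -cross; apply: eq_Ex => w; rewrite /sel.
by case: ltgtP => [_|_|<-]; rewrite ?mul0r ?mulr0 ?mul0r.
Qed.

Let mom1_shift a a' c : mom1 (c + a) (c + a') Z = c * Ex Z + (mom1 a 0 Z + mom1 0 a' Z).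
Proof. by rewrite mom1D addr0 add0r -mom1c mom1D. Qed.

Let mom2_shift a a' b b' c :
  mom2 (b + 2 * c * a + c ^+ 2) (b' + 2 * c * a' + c ^+ 2) Z =
  mom2 b 0 Z + mom2 0 b' Z + 2 * c * (mom2 a 0 Z + mom2 0 a' Z)
  + c ^+ 2 * Ex (fun w => Z w ^+ 2).
Proof.
rewrite !mom2D !addr0 !add0r -mom2c.
rewrite [2 * c * mom2 _ _ _](_ : _ = mom2 (2 * c * a) (2 * c * a') Z); last first.
  by rewrite /mom2 -ExZ//; apply: eq_Ex => w; rewrite /sel; case: ifP => _; ring.
by rewrite !mom2D.
Qed.

Let mom2_merge a a' b b' c :
  mom2 (2 * c * a + b) 0 Z + mom2 0 (2 * c * a' + b') Z =
  mom2 b 0 Z + mom2 0 b' Z + 2 * c * (mom2 a 0 Z + mom2 0 a' Z).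
Proof.
rewrite !mom2D !addr0 !add0r.
rewrite [2 * c * mom2 _ _ _](_ : _ = mom2 (2 * c * a) (2 * c * a') Z); last first.
  by rewrite /mom2 -ExZ//; apply: eq_Ex => w; rewrite /sel; case: ifP => _; ring.
by rewrite mom2D; congr mom2; ring.
Qed.

Variables ap am bp bm : R.

(** Expanding the square of [rho * Ex Z + M], with [M] the value of [Mplus], produces the terms of
    [Fplus] in [M], and [rho ^+ 2] times the variance of [Z] is the covariance form. *)
Lemma FplusE : Fplus P Pc N s gp t ap am bp bm K =
  disp P (rho + ap) (rho + am) (bp + 2 * rho * ap + rho ^+ 2) (bm + 2 * rho * am + rho ^+ 2) Z
  - gp t * mom1 (rho + ap) (rho + am) Z.
Proof.
rewrite /Fplus /Mplus /disp quad_covE// meanKE// ge1 lt1 ge2 lt2.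
(* The sum in [Fplus] associates to the left, so the two second moments do not form a subterm. The
   identity is solved for the first of them, and the second cancels in [ring]. *)
rewrite (canRL (addrK _) (mom2_merge ap am bp bm rho)).
by rewrite mom1_shift mom2_shift Ex_Z Ex_Z2; ring.
Qed.

(** The slopes are exchanged because a unit deviation below the target becomes [- Z], which is again
    below the target when [Z > 0]. *)
Lemma FminusE : Fminus P Pc N s gm t ap am bp bm K =
  disp P (rho + am) (rho + ap) (bm + 2 * rho * am + rho ^+ 2) (bp + 2 * rho * ap + rho ^+ 2) Z
  + gm t * mom1 (rho + am) (rho + ap) Z.
Proof.
rewrite /Fminus /Mminus /disp quad_covE// meanKE// le1 gt1 le2 gt2.
rewrite (canRL (addrK _) (mom2_merge am ap bm bp rho)).
by rewrite mom1_shift mom2_shift Ex_Z Ex_Z2; ring.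
Qed.

(** The coefficients [a] and [b] describe the growth in excess of the riskless factor [rho * s t];
    this and the next three identities restore that factor and obtain plain moments. *)
Lemma a_plusE : rho * s t + a_plus P Pc N s t ap am K = mom1 (rho + ap) (rho + am) Z.
Proof. by rewrite /a_plus meanKE// ge1 lt1 mom1_shift Ex_Z; ring. Qed.

Lemma a_minusE : rho * s t + a_minus P Pc N s t ap am K = mom1 (rho + am) (rho + ap) Z.
Proof. by rewrite /a_minus meanKE// le1 gt1 mom1_shift Ex_Z; ring. Qed.

Lemma b_plusE :
  b_plus P Pc N s t ap am bp bm K + 2 * (rho * s t) * a_plus P Pc N s t ap am K
    + (rho * s t) ^+ 2 =
  mom2 (bp + 2 * rho * ap + rho ^+ 2) (bm + 2 * rho * am + rho ^+ 2) Z.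
Proof.
rewrite /b_plus /a_plus meanKE// quad_secondE// ge1 lt1 ge2 lt2 gex ltx.
by rewrite mom2_shift Ex_Z2; ring.
Qed.

Lemma b_minusE :
  b_minus P Pc N s t ap am bp bm K + 2 * (rho * s t) * a_minus P Pc N s t ap am K
    + (rho * s t) ^+ 2 =
  mom2 (bm + 2 * rho * am + rho ^+ 2) (bp + 2 * rho * ap + rho ^+ 2) Z.
Proof.
rewrite /b_minus /a_minus meanKE// quad_secondE// le1 gt1 le2 gt2 lex gtx.
by rewrite mom2_shift Ex_Z2; ring.
Qed.

End Identities.

(** * Independence of successive periods *)

Section Independence.
Context {d : measure_display} {Omega : measurableType d} {R : realType}.
Variable P : probability Omega R.
Implicit Types (V Y : Omega -> R).
Local Open Scope ereal_scope.
Local Open Scope classical_set_scope.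
Import HBNNSimple.

Lemma integral_comp_nnsfun (g : {nnsfun R >-> R}) Y V :
  measurable_fun setT Y -> measurable_fun setT V -> (forall w, (0 <= V w)%R) ->
  \int[P]_w (g (Y w) * V w)%:E =
  \sum_(k \in range g) k%:E * \int[P]_(w in Y @^-1` (g @^-1` [set k])) (V w)%:E.
Proof.
move=> mY mV V0.
have mpre k : measurable (Y @^-1` (g @^-1` [set k])).
  by rewrite -[X in measurable X]setTI; apply: mY => //; exact: measurable_sfunP.
under eq_integral.
  move=> w _; rewrite fimfunE EFinM -fsumEFin// ge0_mule_fsuml; last first.
    by move=> k; rewrite EFinM nnfun_muleindic_ge0.
  over.
rewrite ge0_integral_fsum//; last 2 first.
- move=> k; apply: emeasurable_funM; last exact/measurable_EFinP.
  apply/measurable_EFinP/measurable_funM => //.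
  exact: measurableT_comp.
- by move=> k w _; rewrite mule_ge0 ?lee_fin// -lee_fin EFinM nnfun_muleindic_ge0.
apply: eq_fsbigr => k; rewrite inE => -[x _ gx].
have k0 : (0 <= k)%R by rewrite -gx.
rewrite -ge0_integralZl_EFin//; last 2 first.
- by move=> w _; rewrite lee_fin.
- exact/measurable_funTS/measurable_EFinP.
rewrite [RHS]integral_mkcond; apply: eq_integral => w _.
rewrite epatch_indic /= !indicE -!EFinM; congr EFin.
by rewrite mulrAC.
Qed.

Lemma integral_comp_mul (c : R) Y V (f : R -> R) : (0 <= c)%R ->
  measurable_fun setT Y -> measurable_fun setT V -> (forall w, (0 <= V w)%R) ->
  (forall B, measurable B ->
    \int[P]_(w in Y @^-1` B) (V w)%:E = c%:E * P (Y @^-1` B)) ->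
  measurable_fun setT f -> (forall x, (0 <= f x)%R) ->
  \int[P]_w (f (Y w) * V w)%:E = c%:E * \int[P]_w (f (Y w))%:E.
Proof.
move=> c0 mY mV V0 VY mf f0.
have mf' : measurable_fun setT (EFin \o f) by exact/measurable_EFinP.
pose g := nnsfun_approx measurableT mf'.
have mono (U : Omega -> R) : measurable_fun setT U -> (forall w, (0 <= U w)%R) ->
    (\int[P]_w (g k (Y w) * U w)%:E @[k --> \oo] --> \int[P]_w (f (Y w) * U w)%:E).
  move=> mU U0.
  have -> : \int[P]_w (f (Y w) * U w)%:E = \int[P]_w limn (fun k => (g k (Y w) * U w)%:E).
    apply: eq_integral => w _; apply/esym/cvg_lim => //.
    have := @cvgeZr _ _ _ (fun k => (g k (Y w))%:E) (f (Y w))%:E (U w)%:E.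
    apply => //.
    exact: (@cvg_nnsfun_approx _ _ _ _ measurableT _ mf' (fun x _ => f0 x) (Y w) I).
  apply: cvg_monotone_convergence => //.
  - move=> k; apply/measurable_EFinP/measurable_funM => //.
    exact: measurableT_comp.
  - by move=> k w _; rewrite lee_fin mulr_ge0.
  - move=> w _ a b ab; rewrite lee_fin ler_wpM2r//.
    exact/lefP/nd_nnsfun_approx.
have h1 := mono V mV V0.
(* The right-hand side is the same limit with [V] replaced by [1]. *)
have h2 := mono (cst 1%R) (measurable_cst _) (fun=> ler01).
have -> : \int[P]_w (f (Y w))%:E = \int[P]_w (f (Y w) * cst 1%R w)%:E.
  by apply: eq_integral => w _; rewrite mulr1.
apply: (cvg_unique _ h1) => //.
rewrite (_ : (fun k => _) = fun k => c%:E * \int[P]_w (g k (Y w) * cst 1%R w)%:E).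
  by apply: cvgeZl.
apply/funext => k; rewrite !integral_comp_nnsfun// ge0_mule_fsumr.
  apply: eq_fsbigr => x _; rewrite VY; last exact: measurable_sfunP.
  have -> : \int[P]_(w in Y @^-1` (g k @^-1` [set x])) (cst 1%R w)%:E =
      P (Y @^-1` (g k @^-1` [set x])).
    have mpre : measurable (Y @^-1` (g k @^-1` [set x])).
      by rewrite -[X in measurable X]setTI; apply: mY => //; exact: measurable_sfunP.
    by rewrite -[RHS]mul1e -(integral_cst P mpre).
  by rewrite muleCA.
move=> x; have [x0|x0] := leP 0%R x.
  by rewrite mule_ge0 ?integral_ge0// => w _; rewrite lee_fin.
by rewrite preimage_nnfun0// preimage_set0 integral_set0 mule0.
Qed.

Variables (n : nat) (Pc : nat -> 'I_n -> Omega -> R) (N : nat).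
Hypothesis mPc : forall t i, (t < N)%N -> measurable_fun setT (Pc t i).
Hypothesis indep : indep_returns P Pc N.

Lemma measurable_sigmaP t A : (t < N)%N -> sigmaP Pc t A -> measurable A.
Proof.
move=> tN; apply: smallest_sub; first exact: sigma_algebra_measurable.
move=> _ [i [B [mB ->]]]; rewrite -[X in measurable X]setTI.
exact: mPc.
Qed.

(** Over [Omega] equipped with the sigma-algebra generated by the coordinates of the return, these
    are measurable by construction, and so is their linear combination. *)
Lemma sigmaP_pK t (K : 'rV[R]_n) (B : set R) : measurable B ->
  sigmaP Pc t (pK Pc t K @^-1` B).
Proof.
move=> mB.
pose G := [set A | exists i (B : set R), measurable B /\ A = Pc t i @^-1` B].
have mi i : measurable_fun setT (Pc t i : g_sigma_algebraType G -> R).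
  by move=> _ C mC; rewrite setTI; apply: sub_sigma_algebra; exists i, C.
have : measurable_fun setT (pK Pc t K : g_sigma_algebraType G -> R).
  by apply: measurable_sum => i; apply: measurable_funM => //.
by move=> /(_ measurableT _ mB); rewrite setTI.
Qed.

Lemma sigmaP_setT t : sigmaP Pc t setT.
Proof. by rewrite -(preimage_setT (pK Pc t 0)); exact: sigmaP_pK. Qed.

(* Independence of [V] from the returns before period [t], tested on product events. *)
Definition indep_past t V := [/\ integ P V, (forall w, (0 <= V w)%R) &
  forall A : nat -> set Omega, (forall j, (j < t)%N -> sigmaP Pc j (A j)) ->
    \int[P]_(w in \bigcap_(j in [set j | (j < t)%N]) A j) (V w)%:E =
    (Ex P V * \prod_(j < t) fine (P (A j)))%:E].

Let measurable_past t (A : nat -> set Omega) : (t <= N)%N ->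
  (forall j, (j < t)%N -> sigmaP Pc j (A j)) ->
  measurable (\bigcap_(j in [set j | (j < t)%N]) A j).
Proof.
move=> tN sA; apply: bigcap_measurableType => j /= jt.
by apply: (@measurable_sigmaP j); [exact: leq_trans jt tN|exact: sA].
Qed.

(** Base of the backward induction: for a constant, the product rule is the independence of the
    returns themselves. *)
Lemma indep_past_cst (c : R) : (0 <= c)%R -> indep_past N (fun=> c).
Proof.
move=> c0; split=> //; first exact: integ_cst.
move=> A sA; rewrite integral_cst; last exact: measurable_past.
rewrite Ex_cst EFinM; congr (_ * _); apply: etrans (indep sA) _.
rewrite -prodEFin; apply: eq_bigr => j _; rewrite fineK//.
apply: fin_num_measure; apply: (@measurable_sigmaP j) => //; exact: sA.
Qed.

Lemma indep_pastD t V1 V2 : (t <= N)%N -> indep_past t V1 -> indep_past t V2 ->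
  indep_past t (fun w => V1 w + V2 w)%R.
Proof.
move=> tN [i1 p1 e1] [i2 p2 e2]; split.
- exact: integD.
- by move=> w; rewrite addr_ge0.
move=> A sA; rewrite ExD// mulrDl EFinD -e1// -e2// -ge0_integralD//.
- exact: measurable_past.
- by move=> w _; rewrite lee_fin.
- exact/measurable_EFinP/measurable_funTS/integ_measurable/i1.
- by move=> w _; rewrite lee_fin.
- exact/measurable_EFinP/measurable_funTS/integ_measurable/i2.
Qed.

Lemma indep_pastM t K V (f : R -> R) : (t < N)%N -> indep_past t.+1 V ->
  measurable_fun setT f -> (forall x, (0 <= f x)%R) ->
  integ P (fun w => f (pK Pc t K w)) ->
  indep_past t (fun w => f (pK Pc t K w) * V w)%R /\
  Ex P (fun w => f (pK Pc t K w) * V w)%R = (Ex P (fun w => f (pK Pc t K w)) * Ex P V)%R.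
Proof.
move=> tN [iV V0 eV] mf f0 ifY.
have mY : measurable_fun setT (pK Pc t K).
  by apply: measurable_sum => i; apply: measurable_funM => //; exact: mPc.
have mV := integ_measurable iV.
have EV0 : (0 <= Ex P V)%R by exact: Ex_ge0.
have main (A : nat -> set Omega) : (forall j, (j < t)%N -> sigmaP Pc j (A j)) ->
  \int[P]_(w in \bigcap_(j in [set j | (j < t)%N]) A j) (f (pK Pc t K w) * V w)%:E =
  (Ex P V * \prod_(j < t) fine (P (A j)) * Ex P (fun w => f (pK Pc t K w)))%:E.
  move=> sA; set D := \bigcap_(j in _) _.
  have mD : measurable D by apply: measurable_past => //; exact: ltnW.
  pose V' w := (V w * \1_D w)%R.
  have mV' : measurable_fun setT V' by apply: measurable_funM => //; exact: measurable_indic.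
  have V'0 w : (0 <= V' w)%R by rewrite mulr_ge0.
  have c0 : (0 <= Ex P V * \prod_(j < t) fine (P (A j)))%R.
    by rewrite mulr_ge0// prodr_ge0// => j _; rewrite fine_ge0.
  transitivity (\int[P]_w (f (pK Pc t K w) * V' w)%:E).
    rewrite integral_mkcond; apply: eq_integral => w _.
    by rewrite epatch_indic /= -EFinM /V' mulrA.
  rewrite (integral_comp_mul c0 mY mV' V'0 _ mf f0).
    by rewrite [RHS]EFinM -(ExK ifY) expectation.unlock.
  move=> B mB; pose A' j := if j == t then pK Pc t K @^-1` B else A j.
  have mYB : measurable (pK Pc t K @^-1` B).
    by rewrite -[X in measurable X]setTI; exact: mY.
  have prodE : (\prod_(j < t.+1) fine (P (A' j)) =
      \prod_(j < t) fine (P (A j)) * fine (P (pK Pc t K @^-1` B)))%R.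
    rewrite big_ord_recr /=; congr (_ * fine (P _))%R; last by rewrite /A' eqxx.
    by apply: eq_bigr => j _; rewrite /A' (ltn_eqF (ltn_ord j)).
  rewrite -[P (pK _ _ _ @^-1` B)]fineK ?fin_num_measure// -EFinM -mulrA -prodE -eV; last first.
    move=> j; rewrite ltnS leq_eqVlt /A' => /predU1P[->|jt].
      by rewrite eqxx; exact: sigmaP_pK.
    by rewrite (ltn_eqF jt); exact: sA.
  rewrite (_ : \bigcap_(j in _) _ = pK Pc t K @^-1` B `&` D); last first.
    apply/seteqP; split => w /=.
      move=> wA; split.
        by have := wA t (ltnSn t); rewrite /A' eqxx.
      move=> j /= jt; have := wA j (ltnW jt : (j < t.+1)%N).
      by rewrite /A' (ltn_eqF jt).
    move=> [wB wD] j /=; rewrite ltnS leq_eqVlt /A' => /predU1P[->|jt].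
      by rewrite eqxx.
    by rewrite (ltn_eqF jt); exact: wD.
  rewrite integral_mkcondr; apply: eq_integral => w _.
  by rewrite epatch_indic /= -EFinM.
(* With every event equal to [setT] the factorization is the formula for the expectation. Its
   finiteness then provides the integrability of the product. *)
have total : \int[P]_w (f (pK Pc t K w) * V w)%:E =
    (Ex P (fun w => f (pK Pc t K w)) * Ex P V)%:E.
  have := main (fun=> setT) (fun j _ => @sigmaP_setT j).
  rewrite (_ : \bigcap_(j in _) _ = setT); last by apply/seteqP; split.
  move=> ->; rewrite big1 ?mulr1 1?mulrC// => j _.
  by rewrite probability_setT.
have ifV : integ P (fun w => f (pK Pc t K w) * V w)%R.
  apply/integrableP; split.
    apply/measurable_EFinP/measurable_funM => //.
    exact: measurableT_comp mf mY.
  under eq_integral do rewrite /= ger0_norm ?mulr_ge0//.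
  by rewrite total ltry.
have EfV : Ex P (fun w => f (pK Pc t K w) * V w)%R = (Ex P (fun w => f (pK Pc t K w)) * Ex P V)%R.
  by rewrite [LHS]/Ex expectation.unlock total.
split=> //; split => //; first by move=> w; rewrite mulr_ge0.
by move=> A sA; rewrite main// EfV; congr EFin; ring.
Qed.

(** Splitting by the sign of [y] leaves two products, each with a single [V], so no joint
    information on [V1] and [V2] enters. *)
Lemma indep_past_sel t K V1 V2 (k y : R -> R) : (t < N)%N ->
  indep_past t.+1 V1 -> indep_past t.+1 V2 ->
  measurable_fun setT k -> measurable_fun setT y -> (forall x, (0 <= k x)%R) ->
  integ P (fun w => k (y (pK Pc t K w))) ->
  indep_past t (fun w => k (y (pK Pc t K w)) * sel (V1 w) (V2 w) (y (pK Pc t K w)))%R /\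
  Ex P (fun w => k (y (pK Pc t K w)) * sel (V1 w) (V2 w) (y (pK Pc t K w)))%R =
  Ex P (fun w => k (y (pK Pc t K w)) * sel (Ex P V1) (Ex P V2) (y (pK Pc t K w)))%R.
Proof.
move=> tN V1t V2t mk my k0 ik.
pose f1 x := (k (y x) * sel 1 0 (y x))%R; pose f2 x := (k (y x) * sel 0 1 (y x))%R.
have mf (p m : R) : measurable_fun setT (fun x => k (y x) * sel p m (y x))%R.
  by apply: measurable_funM; apply: measurableT_comp => //; exact: measurable_sel.
have mpK : measurable_fun setT (pK Pc t K).
  by apply: measurable_sum => i; apply: measurable_funM => //; exact: mPc.
have fi (p m : R) : (0 <= p <= 1)%R -> (0 <= m <= 1)%R ->
    integ P (fun w => k (y (pK Pc t K w)) * sel p m (y (pK Pc t K w)))%R.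
  move=> p1 m1; apply: integ_le ik; first exact: measurableT_comp (mf p m) mpK.
  move=> w /=; rewrite normrM ger0_norm// ler_piMr//.
  by rewrite /sel; case: ifP => _; rewrite ger0_norm; case/andP: p1 m1 => ? ? /andP[].
have i1 : integ P (fun w => f1 (pK Pc t K w)) by apply: fi; rewrite !lexx ler01.
have i2 : integ P (fun w => f2 (pK Pc t K w)) by apply: fi; rewrite !lexx ler01.
have f10 x : (0 <= f1 x)%R by rewrite mulr_ge0// /sel; case: ifP.
have f20 x : (0 <= f2 x)%R by rewrite mulr_ge0// /sel; case: ifP.
have [h1 e1] := indep_pastM tN V1t (mf 1 0)%R f10 i1.
have [h2 e2] := indep_pastM tN V2t (mf 0 1)%R f20 i2.
have E : (fun w => k (y (pK Pc t K w)) * sel (V1 w) (V2 w) (y (pK Pc t K w)))%R =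
  (fun w => f1 (pK Pc t K w) * V1 w + f2 (pK Pc t K w) * V2 w)%R.
  by apply/funext => w; rewrite /f1 /f2 /sel; case: ifP => _; ring.
rewrite E; split; first by apply: indep_pastD => //; exact: ltnW.
rewrite ExD; [|by case: h1|by case: h2].
rewrite e1 e2 ![(_ * Ex P V1)%R]mulrC [(_ * Ex P V2)%R]mulrC -!ExZ// -ExD; [|exact: integZ..].
by apply: eq_Ex => w; rewrite /f1 /f2 /sel; case: ifP => _; ring.
Qed.

(* [indep_past] concerns nonnegative variables, for which products need no prior
   integrability; a signed variable is tracked through its two parts and its square. *)
Definition indep_past2 t V := [/\ measurable_fun setT V,
  indep_past t (fun w => Num.max (V w) 0)%R,
  indep_past t (fun w => Num.max (- V w) 0)%R &
  indep_past t (fun w => V w ^+ 2)%R].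

Lemma indep_past2_cst (c : R) : indep_past2 N (fun=> c).
Proof.
split; first exact: measurable_cst.
- by apply: indep_past_cst; rewrite le_max lexx orbT.
- by apply: indep_past_cst; rewrite le_max lexx orbT.
- exact: indep_past_cst (sqr_ge0 _).
Qed.

Lemma indep_past2_L2 t V : indep_past2 t V -> L2 P V.
Proof. by case=> mV _ _ [iV _ _]. Qed.

Let max_split (x : R) : x = (Num.max x 0 - Num.max (- x) 0)%R.
Proof. by rewrite !maxEle oppr_le0; case: ltgtP => [|| ->]; rewrite ?oppr0; lra. Qed.

Let Ex_max_split t V : indep_past2 t V ->
  Ex P V = (Ex P (fun w => Num.max (V w) 0) - Ex P (fun w => Num.max (- V w) 0))%R.
Proof.
move=> [_ [iV _ _] [iV' _ _] _].
by rewrite -ExB//; apply: eq_Ex => w; exact: max_split.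
Qed.

(** The weight [|Y|] is nonnegative, so taking the positive part, the negative part or the square of
    [X] acts on [V1] and [V2] separately and [indep_past_sel] applies to each. *)
Lemma indep_past2_sel t K V1 V2 (y : R -> R) : (t < N)%N ->
  indep_past2 t.+1 V1 -> indep_past2 t.+1 V2 ->
  measurable_fun setT y -> L2 P (fun w => y (pK Pc t K w)) ->
  let Y w := y (pK Pc t K w) in
  let X w := (`|Y w| * sel (V1 w) (V2 w) (Y w))%R in
  [/\ indep_past2 t X,
    Ex P X = Ex P (fun w => `|Y w| * sel (Ex P V1) (Ex P V2) (Y w))%R &
    Ex P (fun w => X w ^+ 2)%R =
    Ex P (fun w => Y w ^+ 2 * sel (Ex P (fun w => V1 w ^+ 2)) (Ex P (fun w => V2 w ^+ 2)) (Y w))%R].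
Proof.
move=> tN V1t V2t my Y2 Y X.
have [mV1 V1p V1n V1s] := V1t; have [mV2 V2p V2n V2s] := V2t.
have iY : integ P (fun w => Num.norm (y (pK Pc t K w))) by apply/integ_norm/L2_integ.
have mnorm : measurable_fun setT (@Num.norm R R) by exact: normr_measurable.
have [p1 p2] := indep_past_sel tN V1p V2p mnorm my (@normr_ge0 _ _) iY.
have [n1 n2] := indep_past_sel tN V1n V2n mnorm my (@normr_ge0 _ _) iY.
have msq : measurable_fun setT (fun x : R => x ^+ 2)%R by exact: exprn_measurable.
have [s1 s2] := indep_past_sel tN V1s V2s msq my (@sqr_ge0 _) (proj2 Y2).
have Xt : indep_past2 t X.
  split.
  - apply: measurable_funM; first by apply: measurableT_comp => //; case: Y2.
    apply: measurable_fun_ifT => //.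
    by apply: measurable_fun_ler => //; case: Y2.
  - rewrite [X in indep_past t X](_ : _ =
      fun w => (`|Y w| * sel (Num.max (V1 w) 0) (Num.max (V2 w) 0) (Y w))%R)//.
    by apply/funext => w; rewrite /X /sel; case: ifP => _; rewrite maxr_pMr// mulr0.
  - rewrite [X in indep_past t X](_ : _ =
      fun w => (`|Y w| * sel (Num.max (- V1 w) 0) (Num.max (- V2 w) 0) (Y w))%R)//.
    by apply/funext => w; rewrite /X /sel -mulrN; case: ifP => _; rewrite maxr_pMr// mulr0.
  - rewrite [X in indep_past t X](_ : _ =
      fun w => (Y w ^+ 2 * sel (V1 w ^+ 2) (V2 w ^+ 2) (Y w))%R)//.
    by apply/funext => w; rewrite /X /sel; case: ifP => _; rewrite exprMn real_normK ?num_real.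
have iYs c1 c2 : integ P (fun w => `|Y w| * sel c1 c2 (Y w))%R.
  apply: integ_le (integZ (`|c1| + `|c2|) iY).
    apply: measurable_funM; first by apply: measurableT_comp => //; case: Y2.
    by apply: measurableT_comp (measurable_sel c1 c2) _; case: Y2.
  by move=> w /=; rewrite normrM normr_id mulrC ler_wpM2r// sel_bound.
split=> //.
- rewrite (Ex_max_split Xt) (Ex_max_split V1t) (Ex_max_split V2t).
  rewrite (eq_Ex (fun w => `|Y w| * sel (Num.max (V1 w) 0) (Num.max (V2 w) 0) (Y w))%R); last first.
    by move=> w; rewrite /X /sel; case: ifP => _; rewrite maxr_pMr// mulr0.
  rewrite [X in (_ - X)%R](eq_Ex
      (fun w => `|Y w| * sel (Num.max (- V1 w) 0) (Num.max (- V2 w) 0) (Y w))%R); last first.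
    by move=> w; rewrite /X /sel -mulrN; case: ifP => _; rewrite maxr_pMr// mulr0.
  rewrite p2 n2 -[LHS]ExB; [|exact: iYs..].
  by apply: eq_Ex => w; rewrite /sel; case: ifP => _; ring.
- rewrite -s2; apply: eq_Ex => w.
  by rewrite /X /sel; case: ifP => _; rewrite exprMn real_normK ?num_real.
Qed.

End Independence.

(** * Terminal wealth *)

Section Wealth.
Context {d : measure_display} {Omega : measurableType d} {R : realType}.
Variables (P : probability Omega R) (n : nat) (Pc : nat -> 'I_n -> Omega -> R).
Variables (N : nat) (s : nat -> R) (W : R).
Hypothesis s_gt0 : forall t, (t < N)%N -> 0 < s t.
Local Notation rho := (rho N s).
Local Notation lvl := (lvl N s W).

Lemma rho_rec t : (t < N)%N -> rho t = rho t.+1 * s t.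
Proof. by move=> tN; rewrite /Defs.rho big_ltn// mulrC. Qed.

Lemma rho_end : rho N = 1.
Proof. by rewrite /Defs.rho big_geq. Qed.

Lemma rho_gt0 t : 0 < rho t.
Proof.
rewrite /Defs.rho big_nat_cond prodr_gt0// => j; rewrite andbT => /andP[_ jN].
exact: s_gt0.
Qed.

(** The target level earns exactly the riskless return, so deviations from it obey the wealth
    equation without a constant term. *)
Lemma lvl_rec t : (t < N)%N -> s t * lvl t = lvl t.+1.
Proof.
move=> tN; rewrite /Defs.lvl rho_rec//.
have s0 : s t != 0 by rewrite gt_eqF// s_gt0.
have r0 : rho t.+1 != 0 by rewrite gt_eqF// rho_gt0.
by field; rewrite s0 r0.
Qed.

Lemma lvl_end : lvl N = W.
Proof. by rewrite /Defs.lvl rho_end invr1 mul1r. Qed.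

Lemma rho_lvl t : rho t * lvl t = W.
Proof. by rewrite /Defs.lvl mulrA mulfV ?mul1r// gt_eqF// rho_gt0. Qed.

Variables Kp Km : nat -> 'rV[R]_n.

(* Terminal value of [X_t - lvl t] when it equals [1] ([b = true]) or [-1] at time
   [t], after [m] periods of the policy [uTC]. *)
Fixpoint growth (b : bool) (t m : nat) (w : Omega) : R :=
  if m is m'.+1 then
    let y := if b then Zt Pc s t (Kp t) w else - Zt Pc s t (Km t) w in
    `|y| * sel (growth true t.+1 m' w) (growth false t.+1 m' w) y
  else if b then 1 else -1.

(** Under the policy one period multiplies the deviation by [Zt] at [Kp t] or [Km t] according to
    its sign, and positive homogeneity moves the factor [|X w - lvl t|] to the front. *)
Lemma run_growth m t (X : Omega -> R) w : (t + m = N)%N ->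
  run Pc s (uTC N s W Kp Km) t m X w =
  W + `|X w - lvl t| * sel (growth true t m w) (growth false t m w) (X w - lvl t).
Proof.
elim: m t X => [|m IH] t X.
  rewrite addn0 => -> /=; rewrite lvl_end /sel; case: ifPn => [h|].
    by rewrite ger0_norm//; ring.
  by rewrite -ltNge => h; rewrite ltr0_norm//; ring.
rewrite addnS => tmN; have tN : (t < N)%N by rewrite -tmN ltnS leq_addr.
have tmN' : (t.+1 + m = N)%N by rewrite addSn.
rewrite [LHS]/= (IH _ _ tmN') /=; congr (W + _).
rewrite -lvl_rec// /uTC -subr_ge0; set y := X w - lvl t.
have [y0|y0] := leP 0 y.
- rewrite pKZ (_ : _ - _ = y * Zt Pc s t (Kp t) w); last by rewrite /y /Zt; ring.
  rewrite [X in _ = _ * X]/sel y0 normrM -mulrA.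
  have [->|yn0] := eqVneq y 0; first by rewrite normr0 !mul0r.
  by rewrite selpZ// lt_neqAle eq_sym yn0.
- rewrite pKZ (_ : _ - _ = - y * - Zt Pc s t (Km t) w); last by rewrite /y /Zt; ring.
  rewrite [X in _ = _ * X]/sel leNgt y0 /= normrM normrN -mulrA.
  by rewrite selpZ// oppr_gt0.
Qed.

Hypothesis PcL2 : forall t i, (t < N)%N -> L2 P (Pc t i).
Hypothesis indep : indep_returns P Pc N.

Let mPc t i : (t < N)%N -> measurable_fun setT (Pc t i).
Proof. by move=> tN; case: (PcL2 i tN). Qed.

(** Growth started from [-1] has a mean of opposite sign, [- alpha am]; this turns it back into a
    slope. *)
Lemma norm_sel (p m z : R) : `|z| * sel p (- m) z = sel p m z * z.
Proof.
rewrite /sel; case: ifPn => [z0|]; first by rewrite ger0_norm// mulrC.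
by rewrite -ltNge => z0; rewrite ltr0_norm// mulrNN mulrC.
Qed.

(** * Moments of the terminal deviation along the recursion *)

Section Moments.
Variables (t0 : nat) (gp gm ap am bp bm : nat -> R).
Hypothesis rec : recursion_from P Pc N s gp gm t0 Kp Km ap am bp bm.

(* Mean and second moment of the terminal deviation per unit of deviation at time [t]. *)
Definition alpha (a : nat -> R) t := rho t + a t.
Definition second (a b : nat -> R) t := b t + 2 * rho t * a t + rho t ^+ 2.

Let recE t : (t0 <= t < N)%N ->
  [/\ alpha ap t = mom1 P (alpha ap t.+1) (alpha am t.+1) (Zt Pc s t (Kp t)),
      alpha am t = mom1 P (alpha am t.+1) (alpha ap t.+1) (Zt Pc s t (Km t)),
      second ap bp t = mom2 P (second ap bp t.+1) (second am bm t.+1) (Zt Pc s t (Kp t)) &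
      second am bm t = mom2 P (second am bm t.+1) (second ap bp t.+1) (Zt Pc s t (Km t))].
Proof.
move=> /[dup] t0N /andP[_ tN]; have [_ _ _ _ /(_ t t0N) [_ _ [ea em eb ec]]] := rec.
have L t' := @PcL2 t t' tN.
split.
- by rewrite -a_plusE// /alpha rho_rec// ea.
- by rewrite -a_minusE// /alpha rho_rec// em.
- by rewrite -b_plusE// /second rho_rec// ea eb.
- by rewrite -b_minusE// /second rho_rec// em ec.
Qed.

(** Induction on the number [m] of remaining periods. Independence from the past is carried along
    because the moments factor across a period only through it. *)
Lemma growth_moments m t : (t + m = N)%N -> (t0 <= t)%N ->
  [/\ indep_past2 P Pc t (growth true t m), indep_past2 P Pc t (growth false t m) &
  [/\ Ex P (growth true t m) = alpha ap t, Ex P (growth false t m) = - alpha am t,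
      Ex P (fun w => growth true t m w ^+ 2) = second ap bp t &
      Ex P (fun w => growth false t m w ^+ 2) = second am bm t]].
Proof.
elim: m t => [|m IH] t.
  rewrite addn0 => -> _; have [a0 a0' b0 b0' _] := rec.
  split; [exact: indep_past2_cst|exact: indep_past2_cst|].
  rewrite /alpha /second a0 a0' b0 b0' rho_end /= !Ex_cst; split; ring.
rewrite addnS => tmN t0t; have tN : (t < N)%N by rewrite -tmN ltnS leq_addr.
have [|//|Gp Gm [ep em qp qm]] := IH t.+1; first by rewrite addSn.
  exact: leqW.
have [rp rm sp sm] := recE (introT andP (conj t0t tN)).
have L i := PcL2 i tN.
pose yp (z : R) := s t + z; pose ym (z : R) := - (s t + z).
have myp : measurable_fun setT yp by exact: measurable_funD.
have mym : measurable_fun setT ym by exact: measurableT_comp (@oppr_measurable _ _) myp.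
have LZ K : L2 P (Zt Pc s t K) by exact: L2_affine.
have Lp : L2 P (fun w => yp (pK Pc t (Kp t) w)) by exact: LZ.
have Lm : L2 P (fun w => ym (pK Pc t (Km t) w)).
  rewrite (_ : (fun _ => _) = fun w => -1 * Zt Pc s t (Km t) w); first exact: L2Z.
  by apply/funext => w; rewrite mulN1r.
have [i1 e1 q1] := indep_past2_sel mPc tN Gp Gm myp Lp.
have [i2 e2 q2] := indep_past2_sel mPc tN Gp Gm mym Lm.
rewrite ep em in e1 e2; rewrite qp qm in q1 q2.
split=> //; split.
- by rewrite rp; apply: etrans e1 _; apply: eq_Ex => w; exact: norm_sel.
- rewrite rm -mom1N//; apply: etrans e2 _; apply: eq_Ex => w; exact: norm_sel.
- by rewrite sp; apply: etrans q1 _; apply: eq_Ex => w; rewrite mulrC.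
- by rewrite sm -mom2N; apply: etrans q2 _; apply: eq_Ex => w; rewrite mulrC.
Qed.

Hypothesis cov_pos : forall t, (t < N)%N -> forall K, K != 0 -> 0 < quad (covP P Pc t) K.

Lemma nondegenerate_moments m t : (t + m = N)%N -> (t0 <= t)%N ->
  nondegenerate (alpha ap t) (second ap bp t) /\ nondegenerate (alpha am t) (second am bm t).
Proof.
elim: m t => [|m IH] t.
  rewrite addn0 => -> _; have [a0 a0' b0 b0' _] := rec.
  have one : nondegenerate (1 : R) 1 by split=> [|_//]; rewrite expr1n subrr.
  rewrite /alpha /second a0 a0' b0 b0' rho_end expr1n mulr0 !addr0 !add0r.
  by split.
rewrite addnS => tmN t0t; have tN : (t < N)%N by rewrite -tmN ltnS leq_addr.
have [|//|gp' gm'] := IH t.+1; first by rewrite addSn.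
  exact: leqW.
have [-> -> -> ->] := recE (introT andP (conj t0t tN)).
have L i := PcL2 i tN.
by split; apply: nondegenerate_step => //; [exact: cov_pos|exact: s_gt0|exact: cov_pos|exact: s_gt0].
Qed.

(** Only the recursion from [t.+1] on enters when [t0 = t.+1], so the minimizers at [t] are obtained
    before any choice at [t]. *)
Lemma argmin_exists g t : (t < N)%N -> (t0 <= t.+1)%N ->
  (exists K, is_argmin (Fplus P Pc N s g t (ap t.+1) (am t.+1) (bp t.+1) (bm t.+1)) K) /\
  (exists K, is_argmin (Fminus P Pc N s g t (ap t.+1) (am t.+1) (bp t.+1) (bm t.+1)) K).
Proof.
move=> tN t0t; have L i := PcL2 i tN.
have [np nm] := nondegenerate_moments (subnKC tN) t0t.
split.
- have [K Kmin] := objective_argmin L (cov_pos tN) np nm (g t) (s t).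
  by exists K => K'; rewrite !FplusE//; exact: Kmin.
- have [K Kmin] := objective_argmin L (cov_pos tN) nm np (- g t) (s t).
  by exists K => K'; rewrite !FminusE//; have := Kmin K'; rewrite !mulNr !opprK.
Qed.

(** After an arbitrary first decision [u] the deviation is [Y], which depends on period [t] only;
    the remaining growth is independent of it with known moments. *)
Lemma XT_from_moments t x u : (t < N)%N -> (t0 <= t.+1)%N ->
  let Y w := s t * (x - lvl t) + pK Pc t u w in
  'E_P[XT_from Pc N s (uTC N s W Kp Km) t x u]%E =
    (W + mom1 P (alpha ap t.+1) (alpha am t.+1) Y)%:E /\
  'V_P[XT_from Pc N s (uTC N s W Kp Km) t x u]%E =
    (disp P (alpha ap t.+1) (alpha am t.+1) (second ap bp t.+1) (second am bm t.+1) Y)%:E.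
Proof.
move=> tN t0t Y; have L i := PcL2 i tN.
have [Gp Gm [ep em qp qm]] := growth_moments (subnKC tN) t0t.
pose y (z : R) := s t * (x - lvl t) + z.
have my : measurable_fun setT y by exact: measurable_funD.
have LY : L2 P (fun w => y (pK Pc t u w)) by exact: L2_affine.
have [iX eX qX] := indep_past2_sel mPc tN Gp Gm my LY.
rewrite ep em in eX; rewrite qp qm in qX.
set X := (fun w : Omega => `|_| * _) in iX eX qX.
have XE : XT_from Pc N s (uTC N s W Kp Km) t x u = fun w => W + X w.
  apply/funext => w; rewrite /XT_from run_growth ?subnKC// -lvl_rec//.
  by rewrite (_ : _ - _ = y (pK Pc t u w))// /y; ring.
have X2 := indep_past2_L2 iX.
have iX1 := L2_integ X2; have iX2 := proj2 X2.
have WX : L2 P (fun w => W + X w) by apply: L2D => //; exact: L2_cst.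
have EWX : Ex P (fun w => W + X w) = W + Ex P X by rewrite ExD ?Ex_cst//; exact: integ_cst.
have eX' : Ex P X = mom1 P (alpha ap t.+1) (alpha am t.+1) Y.
  by rewrite eX; apply: eq_Ex => w; exact: norm_sel.
have qX' : Ex P (fun w => X w ^+ 2) = mom2 P (second ap bp t.+1) (second am bm t.+1) Y.
  by rewrite qX; apply: eq_Ex => w; rewrite mulrC.
rewrite XE; split; first by rewrite ExK ?EWX ?eX'//; exact: L2_integ.
rewrite variance_Ex; [|exact: L2_integ|by case: WX].
rewrite EWX /disp -eX' -qX'; congr EFin.
rewrite (eq_Ex (fun w => W ^+ 2 + (2 * W * X w + X w ^+ 2))); last by move=> w; ring.
rewrite !ExD ?ExZ ?Ex_cst; try by integ_tac.
by ring.
Qed.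

End Moments.
End Wealth.

(** * Time consistency *)

Section TimeConsistency.
Context {d : measure_display} {Omega : measurableType d} {R : realType}.
Variables (P : probability Omega R) (n : nat) (Pc : nat -> 'I_n -> Omega -> R).
Variables (N : nat) (s : nat -> R) (W : R) (gp gm : nat -> R).
Hypothesis s_gt0 : forall t, (t < N)%N -> 0 < s t.
Hypothesis PcL2 : forall t i, (t < N)%N -> L2 P (Pc t i).
Hypothesis indep : indep_returns P Pc N.
Variables (Kp Km : nat -> 'rV[R]_n) (ap am bp bm : nat -> R).
Hypothesis rec : recursion_from P Pc N s gp gm 0 Kp Km ap am bp bm.
Local Notation lvl := (lvl N s W).
Local Notation pol := (uTC N s W Kp Km).
Local Notation obj := (nested_obj P Pc N s W gp gm pol).

(** Since [gam] is itself proportional to the deviation, variance and mean term scale by the same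
    square. The remaining term in [W] does not involve [K]. *)
Let obj_pos t x K : (t < N)%N -> 0 < x - lvl t ->
  obj t x ((x - lvl t) *: K) =
  ((x - lvl t) ^+ 2 * Fplus P Pc N s gp t (ap t.+1) (am t.+1) (bp t.+1) (bm t.+1) K
   - gp t * (x - lvl t) * W)%:E.
Proof.
move=> tN y0; have L i := PcL2 i tN.
have LZ : L2 P (Zt Pc s t K) by exact: L2_affine.
have [e v] := XT_from_moments W s_gt0 PcL2 indep rec x ((x - lvl t) *: K) tN isT.
rewrite /nested_obj e v /gam -subr_ge0 ltW// FplusE//.
rewrite (_ : (fun w => _) = fun w => (x - lvl t) * Zt Pc s t K w); last first.
  by apply/funext => w; rewrite pKZ /Zt; ring.
rewrite dispZ ?mom1Z ?ltW// -EFinM -EFinB; congr EFin.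
by rewrite /alpha /second; ring.
Qed.

Let obj_neg t x K : (t < N)%N -> x - lvl t < 0 ->
  obj t x ((x - lvl t) *: K) =
  ((x - lvl t) ^+ 2 * Fminus P Pc N s gm t (ap t.+1) (am t.+1) (bp t.+1) (bm t.+1) K
   + gm t * (x - lvl t) * W)%:E.
Proof.
move=> tN y0; have L i := PcL2 i tN.
have LZ : L2 P (Zt Pc s t K) by exact: L2_affine.
have LNZ : L2 P (fun w => - Zt Pc s t K w).
  rewrite (_ : (fun _ => _) = fun w => -1 * Zt Pc s t K w); first exact: L2Z.
  by apply/funext => w; rewrite mulN1r.
have [e v] := XT_from_moments W s_gt0 PcL2 indep rec x ((x - lvl t) *: K) tN isT.
rewrite /nested_obj e v /gam -subr_ge0 leNgt y0 FminusE//.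
rewrite (_ : (fun w => _) = fun w => - (x - lvl t) * - Zt Pc s t K w); last first.
  by apply/funext => w; rewrite pKZ /Zt; ring.
have y0' : 0 <= - (x - lvl t) by rewrite oppr_ge0 ltW.
rewrite dispZ// mom1Z// dispN// mom1N// -EFinM -EFinB; congr EFin.
by rewrite /alpha /second; ring.
Qed.

(** Off the target level every [u] is the deviation times some [K], so minimizing over [u] amounts
    to minimizing [Fplus] or [Fminus]. *)
Lemma uTC_time_consistent : time_consistent P Pc N s W gp gm pol.
Proof.
move=> t tN x u.
have [_ _ _ _ /(_ t) recs] := rec; have [Kpmin Kmmin _] := recs tN.
have -> : pol t x = (x - lvl t) *: (if 0 <= x - lvl t then Kp t else Km t).
  by rewrite /uTC subr_ge0; case: ifP.
have [y0|y0|y0] := ltgtP 0 (x - lvl t).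
- rewrite -[u](scalerKV (a := x - lvl t)) ?gt_eqF// !obj_pos// lee_fin lerB//.
  by rewrite ler_wpM2l// sqr_ge0.
- rewrite -[u](scalerKV (a := x - lvl t)) ?lt_eqF// !obj_neg// lee_fin lerD2r.
  by rewrite ler_wpM2l// sqr_ge0.
(* On the target level risk aversion and policy both vanish; the objective is then a variance, and
   the policy attains the value zero. *)
- have [_ v] := XT_from_moments W s_gt0 PcL2 indep rec x (0 : 'rV[R]_n) tN isT.
  have g0 : gam N s W gp gm t x = 0 by rewrite /gam -subr_ge0 -y0 lexx mulr0.
  rewrite /nested_obj g0 !mul0e !sube0 -y0 scale0r v.
  rewrite (_ : (fun w => _) = fun=> 0); last first.
    by apply/funext => w; rewrite -y0 pK0 mulr0 addr0.
  by rewrite /disp /mom1 /mom2 !Ex_cst expr0n !mulr0 expr0n subr0 variance_ge0.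
Qed.

Lemma XT_moments x0 :
  'E_P[XT Pc N s pol x0]%E =
    (rho N s 0%N * x0 + (if lvl 0 <= x0 then ap 0%N * (x0 - lvl 0) else am 0%N * (x0 - lvl 0)))%:E /\
  'V_P[XT Pc N s pol x0]%E =
    ((if lvl 0 <= x0 then bp 0%N - ap 0%N ^+ 2 else bm 0%N - am 0%N ^+ 2) * (x0 - lvl 0) ^+ 2)%:E.
Proof.
have [Gp Gm [ep em qp qm]] := growth_moments PcL2 indep rec (add0n N) (leq0n _).
(* The sign of the initial deviation is known, so terminal wealth is an affine function of a single
   growth variable. *)
have affine k G : L2 P G ->
    'E_P[fun w => (W + k * G w)%R]%E = (W + k * Ex P G)%:E /\
    'V_P[fun w => (W + k * G w)%R]%E = (k ^+ 2 * (Ex P (fun w => G w ^+ 2) - Ex P G ^+ 2))%:E.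
  move=> G2; have iG := L2_integ G2; have iG2 := proj2 G2.
  have L : L2 P (fun w => W + k * G w) by integ_tac.
  have E : Ex P (fun w => W + k * G w) = W + k * Ex P G.
    by rewrite ExD ?ExZ ?Ex_cst//; integ_tac.
  split; first by rewrite ExK ?E//; exact: L2_integ.
  rewrite variance_Ex; [|exact: L2_integ|by case: L].
  rewrite E (eq_Ex (fun w => W ^+ 2 + (2 * W * k * G w + k ^+ 2 * G w ^+ 2))).
    rewrite !ExD ?ExZ ?Ex_cst; try by integ_tac.
    by congr EFin; ring.
  by move=> w; ring.
have XE : XT Pc N s pol x0 = fun w => W + `|x0 - lvl 0| *
    (if lvl 0 <= x0 then growth Pc s Kp Km true 0 N w else growth Pc s Kp Km false 0 N w).
  by apply/funext => w; rewrite /XT run_growth// /sel subr_ge0.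
have Wr := rho_lvl W s_gt0 0.
rewrite XE; move: Wr; set c := lvl 0 => Wr.
case: ifPn => [h|]; [|rewrite -ltNge => h].
- have [-> ->] := affine `|x0 - c| _ (indep_past2_L2 Gp).
  rewrite ep qp ger0_norm ?subr_ge0// /alpha /second.
  by split; congr EFin; rewrite -?Wr; ring.
- have [-> ->] := affine `|x0 - c| _ (indep_past2_L2 Gm).
  rewrite em qm ltr0_norm ?subr_lt0// /alpha /second.
  by split; congr EFin; rewrite -?Wr; ring.
Qed.

End TimeConsistency.

Theorem theorem1 (d : measure_display) (Omega : measurableType d) (R : realType)
  (P : probability Omega R) (n : nat) (Pc : nat -> 'I_n -> Omega -> R)
  (N : nat) (s : nat -> R) (W : R) (gp gm : nat -> R) :
  market_assumptions P Pc N s ->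
  (forall t, (t < N)%N -> 0 <= gp t /\ 0 <= gm t) ->
  (* well-definedness: the minimizers exist at every step *)
  (forall t, (t < N)%N -> forall Kp Km ap am bp bm,
     recursion_from P Pc N s gp gm t.+1 Kp Km ap am bp bm ->
     (exists K, is_argmin (Fplus P Pc N s gp t (ap t.+1) (am t.+1) (bp t.+1) (bm t.+1)) K) /\
     (exists K, is_argmin (Fminus P Pc N s gm t (ap t.+1) (am t.+1) (bp t.+1) (bm t.+1)) K)) /\
  (forall Kp Km ap am bp bm,
     recursion_from P Pc N s gp gm 0 Kp Km ap am bp bm ->
     [/\ forall t, (t <= N)%N -> 0 <= bp t - ap t ^+ 2 /\ 0 <= bm t - am t ^+ 2,
         time_consistent P Pc N s W gp gm (uTC N s W Kp Km) &
         forall x0 : R,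
           let pol := uTC N s W Kp Km in
           let c := lvl N s W 0%N in
           'E_P[XT Pc N s pol x0]%E =
             (rho N s 0%N * x0 + (if c <= x0 then ap 0%N * (x0 - c) else am 0%N * (x0 - c)))%:E /\
           'V_P[XT Pc N s pol x0]%E =
             ((if c <= x0 then bp 0%N - ap 0%N ^+ 2 else bm 0%N - am 0%N ^+ 2) * (x0 - c) ^+ 2)%:E]).

Proof.
move=> [s1 mPc iPc indep [_ cov_pos _]] _.
have s_gt0 t : (t < N)%N -> 0 < s t by move=> tN; rewrite (lt_trans ltr01)// s1.
have PcL2 t i : (t < N)%N -> L2 P (Pc t i).
  by move=> tN; split; [exact: mPc|case: (iPc t i tN)].
split.
  move=> t tN Kp Km ap am bp bm rec; split.
  - by case: (argmin_exists s_gt0 PcL2 rec cov_pos gp tN (leqnn _)).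
  - by case: (argmin_exists s_gt0 PcL2 rec cov_pos gm tN (leqnn _)).
move=> Kp Km ap am bp bm rec; split.
- move=> t tN.
  have [[p0 _] [m0 _]] := nondegenerate_moments s_gt0 PcL2 rec cov_pos (subnKC tN) (leq0n t).
  (* The riskless terms cancel: [second - alpha ^+ 2] equals [b - a ^+ 2]. *)
  split; [move: p0|move: m0]; rewrite /second /alpha; congr (0 <= _); ring.
- exact: (uTC_time_consistent W s_gt0 PcL2 indep rec).
- by move=> x0 /=; exact: (XT_moments W s_gt0 PcL2 indep rec).
Qed.
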